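(* Let $P_1,P_2,V\in\mathbb{C}[X]$, where $P_1,P_2$ are nonzero, not proportional and divisible by $X$, $\gcd(P_1,V)=\gcd(P_2,V)=1$, and let $\beta_0=V(0)\neq0$. Let $\nu_1\ge\nu_2=\nu\ge1$ be the multiplicities of $P_1,P_2$ at $0$. Assume that $P_1/V$ and $P_2/V$ are defined on $\bar D_1$ and bounded by $1$ in absolute value there. Let $g_\lambda(z)=Q_\lambda\bigl(P_1(z)/V(z),P_2(z)/V(z)\bigr)$, where $Q_\lambda$, $\lambda\in\mathbb{C}^m$, is the lacunary family described in the context, with $m\ge2$. Assume that at least one of the following lacunarity conditions holds: - $\nu n_{\ell+1}>n_\ell D$ for all $0\le\ell\le\ell_d-1$; - $\nu_1=\nu_2$ and $\nu n_{\ell+1}>\nu n_\ell+(k+1)(\tau_\ell-1)$ for all $0\le\ell\le\ell_d-1$; - $\nu_1\neq\nu_2$ and $\bar\nu_{\ell+1}>\widetilde\nu_\ell$ for all $0\le\ell\le\ell_d-1$. Then the maximal number $\mathcal{Z}$ of zeros (counted with multiplicity) of $g_\lambda$ in $\bar D_{1/4}$, over all $\lambda$ with $g_\lambda\not\equiv0$, satisfies: - if $\nu_1\ne\nu_2$, $$\mathcal{Z}\le 5(\widetilde\nu_{\ell_d}+1)\log2+\frac52(m+1)\log m+5(\bar t-m)\log\left(\frac{|\beta_0|}{|\alpha_0|}\right)+5\bigl(\overline{\tau n}-(\bar t-m)\bigr)\log\left(\frac{|\beta_0|}{|a_0|}\right);$$ - if $\nu_1=\nu_2$, $$\mathcal{Z}\le5\bigl(\nu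 d+(k+1)\tau_{\ell_d}-k\bigr)\log2+5\log\left(2+\frac{4m^{\frac{m+1}2}}{3\bar C\,|\mu|^{\bar t-\bar\tau}\,|a_0/\beta_0|^{\overline{\tau n}-\bar\tau'}\,|\bar\delta_k/\beta_0|^{\bar\tau'}}\right).$$
   Context: For $\rho>0$, $\bar D_\rho=\{z\in\mathbb{C}:|z|\le\rho\}$. Curve. $D_i=\deg P_i\ge 1$, $D=\max(D_1,D_2)$. Write $P_1(X)=X^{\nu_1}\sum_{i=0}^{D_1-\nu_1}\alpha_iX^i$, $P_2(X)=X^{\nu_2}\sum_{i=0}^{D_2-\nu_2}a_iX^i$ with $\alpha_0,a_0\ne0$; coefficients with index beyond the degree are $0$. By convention (up to permuting the variables) $\nu_1\ge\nu_2$, and $\nu=\nu_2$. Lacunary family. Integers $0\le n_0<n_1<\dots<n_{\ell_d}=d$ are given, and for each $\ell\in\{0,\dots,\ell_d\}$ a nonempty set $T_\ell=\{t_{\ell,1}<\dots<t_{\ell,\tau_\ell}\}\subset\{1,\dots,n_\ell+1\}$. Set $m=\sum_{\ell=0}^{\ell_d}\tau_\ell$ and, for $\lambda=(\lambda_{\ell,i})\in\mathbb{C}^m$, $$Q_\lambda(X,Y)=\sum_{\ell=0}^{\ell_d}\sum_{i=1}^{\tau_\ell}\lambda_{\ell,i}X^{t_{\ell,i}-1}Y^{n_\ell-(t_{\ell,i}-1)}.$$ Notation. For each $\ell$: $\bar\nu_\ell=(t_{\ell,1}-1)\nu_1+(n_\ell-(t_{\ell,1}-1))\nu_2$ and $\widetilde\nu_\ell=(t_{\ell,\tau_\ell}-1)\nu_1+(n_\ell-(t_{\ell,\tau_\ell}-1))\nu_2$.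 If $\nu_1=\nu_2$: $\mu=\alpha_0/a_0$; $k\ge0$ is the largest integer such that $\alpha_i=\mu a_i$ for all $0\le i\le k$; $\bar\delta_k=\alpha_{k+1}-\mu a_{k+1}$. $\bar t=\sum_{\ell}\sum_{i=1}^{\tau_\ell}t_{\ell,i}$, $\overline{\tau n}=\sum_\ell\tau_\ell n_\ell$, $\bar\tau=\sum_\ell\frac{\tau_\ell(\tau_\ell+1)}2$, $\bar\tau'=\sum_\ell\frac{\tau_\ell(\tau_\ell-1)}2$, and $$\bar C=\prod_{\ell=0}^{\ell_d}C_\ell,\qquad C_\ell=\prod_{i=1}^{\tau_\ell}\frac{\prod_{j<i}(t_{\ell,i}-t_{\ell,j})}{(i-1)!}.$$ *)

(* Defs.v *)
From HB Require Import structures.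
From mathcomp Require Import all_boot all_order all_algebra.
From mathcomp Require Import complex.
From mathcomp Require Import all_classical all_reals all_analysis.

Set Implicit Arguments.
Unset Strict Implicit.
Unset Printing Implicit Defensive.

Import Order.TTheory GRing.Theory Num.Theory.
Import numFieldNormedType.Exports.

Local Open Scope classical_set_scope.
Local Open Scope ring_scope.

(* The modulus of a complex number, as a real number; the norm `|z| of R[i] is
   complex-valued. *)
Notation modulus := ComplexField.Normc.normc.

Definition closed_disc (R : realType) (r : R) : set R[i] :=
  [set z | modulus z <= r].

Section zeros.
Variable R : realType.
Local Notation C := R[i].
Implicit Types (g : C -> C) (A : set C).

(* g(z) = (z - z0)^k h(z) near z0 with h holomorphic near z0, h(z0) <> 0; for
   k = 0 this says that g is holomorphic and nonzero at z0. *)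
Definition zero_mult g (z0 : C) (k : nat) : Prop :=
  exists h : C -> C,
    [/\ \forall z \near (z0 : C^o), derivable (h : C^o -> C^o) z 1,
        h z0 != 0
      & \forall z \near (z0 : C^o), g z = (z - z0) ^+ k * h z].

(* The zeros of g in A, listed with multiplicity, form a sequence of size N. *)
Definition nb_zeros g A (N : nat) : Prop :=
  exists s : seq C,
    [/\ forall z, z \in s -> A z,
        forall z, A z -> zero_mult g z (count_mem z s)
      & size s = N].

Definition max_nb_zeros (L : Type) (g : L -> C -> C) (adm : set L) A (Z : nat) :
    Prop :=
  (exists2 lam, adm lam & nb_zeros (g lam) A Z) /\
  (forall lam, adm lam -> exists2 N, nb_zeros (g lam) A N & (N <= Z)%N).

End zeros.

Section curve.
Variable F : fieldType.
Implicit Types P : {poly F}.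

Definition deg P : nat := (size P).-1.

(* the multiplicity of P at 0 *)
Definition val0 P : nat := mup 0 P.

(* the coefficient of index i of P / X^(val0 P) *)
Definition redcoef P (i : nat) : F := P`_(val0 P + i).

Definition mu P1 P2 : F := redcoef P1 0 / redcoef P2 0.

Definition agree P1 P2 (k : nat) : Prop :=
  forall i, (i <= k)%N -> redcoef P1 i = mu P1 P2 * redcoef P2 i.

Definition agree_max P1 P2 (k : nat) : Prop :=
  agree P1 P2 k /\ forall j, agree P1 P2 j -> (j <= k)%N.

Definition delta P1 P2 (k : nat) : F :=
  redcoef P1 k.+1 - mu P1 P2 * redcoef P2 k.+1.

End curve.

(* T l lists the set T_l in increasing order, so that t_(l, i) of the usual
   1-based notation is nth 0 (T l) i.-1 and tau_l is size (T l). *)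
Section lacunary.
Variables (ld : nat) (n : 'I_ld.+1 -> nat) (T : 'I_ld.+1 -> seq nat).
Implicit Types l : 'I_ld.+1.

Definition lacunary_family : Prop :=
  {homo n : l l' / (l < l')%N >-> (l < l')%N} /\
  forall l, [/\ T l != [::], sorted ltn (T l)
              & all (fun t => 1 <= t <= (n l).+1)%N (T l)].

Definition tau l : nat := size (T l).
Definition t_ l (i : nat) : nat := nth 0%N (T l) i.

Definition nb_param : nat := \sum_l tau l.

(* C^m, indexed by the pairs (l, i) with i < tau_l *)
Definition param (C : Type) : Type := forall l, 'I_(tau l) -> C.

(* 'X is the outer variable, with coefficients in C['Y]. *)
Definition Q (C : fieldType) (lam : param C) : {poly {poly C}} :=
  \sum_l \sum_(i < tau l)
    (lam l i)%:P%:P * 'X ^+ (t_ l i).-1 * 'Y ^+ (n l - (t_ l i).-1).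

Definition Qeval (C : fieldType) (lam : param C) (x y : C) : C :=
  (Q lam).[x, y].

Definition g_ (C : fieldType) (P1 P2 V : {poly C}) (lam : param C) (z : C) : C :=
  Qeval lam (P1.[z] / V.[z]) (P2.[z] / V.[z]).

Definition tmin l : nat := head 0%N (T l).
Definition tmax l : nat := last 0%N (T l).

Definition nu_bar (nu1 nu2 : nat) l : nat :=
  (tmin l).-1 * nu1 + (n l - (tmin l).-1) * nu2.
Definition nu_tilde (nu1 nu2 : nat) l : nat :=
  (tmax l).-1 * nu1 + (n l - (tmax l).-1) * nu2.

Definition t_bar : nat := \sum_l \sum_(i < tau l) t_ l i.
Definition taun_bar : nat := \sum_l tau l * n l.
Definition tau_bar : nat := \sum_l (tau l * (tau l).+1) %/ 2.
Definition tau_bar' : nat := \sum_l (tau l * (tau l).-1) %/ 2.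

(* i is 0-based here, hence i`! instead of (i - 1)! *)
Definition C_bar (R : realType) : R :=
  \prod_l \prod_(i < tau l)
    ((\prod_(j < i) ((t_ l i)%:R - (t_ l j)%:R)) / i`!%:R).

End lacunary.

(* Main.v *)
(* Write f1 = P1/V, f2 = P2/V and let A be the square matrix of the Taylor
   coefficients of the m monomials f1^(t-1) f2^(n-t+1), taken at well-chosen
   indices at most N.  Lacunarity makes A block triangular, which gives det A in
   closed form.  The entries of A are bounded by 1 (Cauchy), so by Cramer and
   Hadamard a large parameter lambda forces one of the first N + 1 Taylor
   coefficients of g_lambda to be large.  On the other hand dividing g_lambda by
   its Z zeros in the disc of radius 1/4 and applying Cauchy's estimate to the
   quotient bounds the coefficient of index i by 8^i 2^-Z sum |lambda|.
   Comparing the two gives |det A|^2 4^Z <= m^(m+2) 64^N, and together with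
   Hadamard's |det A|^2 <= m^m this implies both bounds. *)

(* The indices depend on the case. If ν1 ≠ ν2, the monomials of one block have distinct orders at 0,
   and these orders are the indices. If ν1 = ν2, all monomials of degree n_ℓ have the same order ν
   n_ℓ. They are separated by writing P1 = μ P2 + X^(ν+k+1) q with q(0) = [delta P1 P2 k]: expanding
   the powers of P1 in powers of q yields terms of order ν n_ℓ + (k+1)s, and these are the indices.
   The binomial coefficients of the expansion produce the constant [C_bar]. No power series or
   contour integral occurs. A Taylor coefficient of P/W is a coefficient of the polynomial P S,
   where S inverts W modulo a power of X, and Cauchy's estimate is an average over roots of unity.
   The factor 5 absorbs 3/log 2: after logarithms the determinant inequality gives Z log 2 ≤ 3 N log
   2 + 2y, with y the logarithm of m^((m+1)/2) / |det A|, and log 2 ≥ 3/5 makes 3N ≤ 5 N log 2. *)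
Require Import Defs.
From HB Require Import structures.
From mathcomp Require Import cyclic separable cyclotomic.
From mathcomp Require Import all_boot all_order all_algebra.
From mathcomp Require Import complex.
From mathcomp Require Import all_classical all_reals all_analysis.
From mathcomp Require Import zify ring lra.

Import Order.TTheory GRing.Theory Num.Theory.
Import numFieldNormedType.Exports.

Local Open Scope classical_set_scope.
Local Open Scope ring_scope.

Set Implicit Arguments.
Unset Strict Implicit.

(** * Hadamard and Cramer *)

Section hadamard.
Variable C : numClosedFieldType.
Local Open Scope sesquilinear_scope.
Local Notation "''[' u , v ]" := (dotmx u v) : ring_scope.
Local Notation "''[' u ]" := '[u, u]%R : ring_scope.

(** Gram-Schmidt writes A = L U with U unitary and L lower triangular. The diagonal entries of L are
    the scalar products of the i-th rows of A and U, so Cauchy-Schwarz bounds them by the norms of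
    the rows of A. *)
Lemma Hadamard n (A : 'M[C]_n) :
  `|\det A| ^+ 2 <= \prod_i \sum_j `|A i j| ^+ 2.
Proof.
set U := schmidt A.
have Uu : U \is unitarymx by exact: schmidt_unitarymx.
set L := A *m U ^t*.
have LE i j : L i j = '[row i A, row j U].
  by rewrite dotmxE !mxE; apply: eq_bigr => k _; rewrite !mxE.
have AE : A = L *m U by rewrite /L mulmxKtV.
have dU : `|\det U| = 1.
  have /unitarymxP/(congr1 determinant) := Uu.
  rewrite det_mulmx det1 -map_trmx det_tr det_map_mx -normCK => /eqP.
  by rewrite sqrf_eq1 => /orP[/eqP//|/eqP h]; have := normr_ge0 (\det U); rewrite h ler0N1.
(* Row i of A lies in the span of the rows of U of index at most i, which are orthogonal to row j
   when i < j. *)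
have Ltrig : is_trig_mx L.
  apply/is_trig_mxP => i j ij; rewrite LE.
  have /row_unitarymxP Uo := Uu.
  have /sub_sumsmxP[u ->] := row_schmidt_sub A i.
  rewrite dotmxE mulmx_suml summxE big1// => k ki.
  have /submxP[w ->] : (u k *m <<row k U>> <= row k U)%MS.
    by rewrite (submx_trans (submxMl _ _))// genmxE.
  rewrite (mx11_scalar w) mul_scalar_mx -scalemxAl mxE -dotmxE Uo.
  case: eqVneq => [kj|_]; last by rewrite mulr0.
  by rewrite kj leqNgt ij in ki.
rewrite {1}AE det_mulmx normrM dU mulr1 det_trig// normr_prod -prodrXl.
apply: ler_prod => i _; rewrite exprn_ge0//= LE.
have UU : '[row i U] = 1 by have /row_unitarymxP -> := Uu; rewrite eqxx.
have [+ _] := CauchySchwarz (@dotmx C n) (row i A) (row i U).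
rewrite [X in _ <= _ * X -> _]UU mulr1 => /le_trans; apply.
rewrite [X in X <= _]dotmxE !mxE; apply: ler_sum => j _.
by rewrite !mxE normCK.
Qed.

Lemma Cramer_bound n (A : 'M[C]_n) (x b : 'cV[C]_n) (B : C) :
  (forall i j, `|A i j| <= 1) -> (forall i, `|b i 0| <= B) -> A *m x = b ->
  forall j, (`|x j 0| * `|\det A|) ^+ 2 <= n%:R ^+ n * B ^+ 2.
Proof.
move=> A1 bB Axb j.
pose A' : 'M[C]_n := \matrix_(i, k) if k == j then b i 0 else A i k.
(* Cramer's rule replaces a column, whereas Hadamard's bound runs over rows; hence the transpose.
   Row j then contributes n B^2 and each other row n. *)
have -> : `|x j 0| * `|\det A| = `|\det A'^T|.
  rewrite -normrM det_tr; congr `|_|; rewrite (expand_det_col A' j).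
  have : (\adj A *m (A *m x)) j 0 = \det A * x j 0.
    by rewrite mulmxA mul_adj_mx mul_scalar_mx !mxE.
  rewrite mulrC => <-; rewrite Axb mxE; apply: eq_bigr => i _.
  rewrite /A' !mxE eqxx mulrC; congr (_ * (_ * \det _)).
  by apply/matrixP => p q; rewrite !mxE eq_sym (negPf (neq_lift _ _)).
apply: le_trans (Hadamard _) _.
have -> : n%:R ^+ n * B ^+ 2 =
    \prod_(i : 'I_n) (if i == j then n%:R * B ^+ 2 else n%:R : C).
  rewrite (bigD1 j)//= eqxx; under eq_bigr => i /negPf -> do [].
  rewrite prodr_const cardC1 card_ord mulrAC -exprS prednK//.
  exact: leq_ltn_trans (ltn_ord j).
apply: ler_prod => i _; rewrite sumr_ge0/= => [|k _]; last exact: exprn_ge0.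
have B0 k : 0 <= `|b k 0| by [].
case: (eqVneq i j) => [->|ij].
  apply: le_trans (ler_sum _ (G := fun=> B ^+ 2) _) _ => [k _|].
    by rewrite !mxE eqxx lerXn2r ?nnegrE ?(le_trans (B0 k)).
  by rewrite sumr_const card_ord mulr_natl.
apply: le_trans (ler_sum _ (G := fun=> 1) _) _ => [k _|].
  by rewrite !mxE (negPf ij) exprn_ile1.
by rewrite sumr_const card_ord.
Qed.

End hadamard.

(** * Block triangular and binomial determinants *)

Lemma det_castmx (R : comPzRingType) m n (e : m = n) (A : 'M[R]_m) :
  \det (castmx (e, e) A) = \det A.
Proof. by case: _ / e; rewrite castmx_id. Qed.

Lemma det_mxblock_ltrig (R : comPzRingType) p (p_ : 'I_p -> nat)
    (B_ : forall i j, 'M[R]_(p_ i, p_ j)) :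
  (forall i j : 'I_p, (i < j)%N -> B_ i j = 0) ->
  \det (\mxblock_(i, j) B_ i j) = \prod_i \det (B_ i i).
Proof.
elim: p => [|p IH] in p_ B_ *.
  move=> _; rewrite [RHS]big_ord0 det_trig; last first.
    by apply/is_trig_mxP => -[k km]; exfalso; move: km; rewrite big_ord0.
  by apply: big1 => -[k km]; exfalso; move: km; rewrite big_ord0.
move=> B0; rewrite mxblock_recul det_castmx.
have -> : \mxrow_j B_ ord0 (lift ord0 j) = 0.
  by apply/matrixP => i j; rewrite !mxE B0// mxE.
rewrite det_lblock big_ord_recl IH// => i j ij.
by apply: B0; rewrite /= /bump ltnS.
Qed.

Section binomial_matrix.
Variable F : numFieldType.

Lemma ffact_prodr (a s : nat) : (a ^_ s)%:R = \prod_(i < s) (a%:R - i%:R) :> F.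
Proof.
elim: s => [|s IH]; first by rewrite ffactn0 big_ord0.
rewrite ffactnSr natrM big_ord_recr IH/=.
case: (leqP s a) => [sa|sa]; first by rewrite natrB.
have -> : (\prod_(i < s) (a%:R - i%:R) : F) = 0.
  by rewrite (bigD1 (Ordinal sa))//= subrr mul0r.
by rewrite !mul0r.
Qed.

(* The falling factorials are obtained from the powers by a unitriangular
   change of basis, so this reduces to a Vandermonde determinant. *)
Lemma det_binomial n (a : nat -> nat) :
  \det (\matrix_(s < n, i < n) ('C(a i, s))%:R : 'M[F]_n) =
  \prod_(i < n) ((\prod_(j < i) ((a i)%:R - (a j)%:R)) / i`!%:R).
Proof.
pose p s : {poly F} := \prod_(i < s) ('X - (i%:R)%:P).
have sp s : size (p s) = s.+1.
  by rewrite /p size_prod_XsubC /index_enum -enumT size_enum_ord.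
have pm s : p s \is monic by exact: monic_prod_XsubC.
pose E : 'M[F]_n := \matrix_(s, j) (p s)`_j.
pose V : 'M[F]_n := Vandermonde n (\row_j (a j)%:R).
pose D : 'M[F]_n := diag_mx (\row_s s`!%:R).
set B := (X in \det X).
have DB : D *m B = E *m V.
  apply/matrixP => s i; rewrite mul_diag_mx !mxE -natrM mulnC bin_ffact.
  rewrite ffact_prodr.
  have := @horner_coef_wide _ n (p s) (a i)%:R; rewrite sp => /(_ (ltn_ord s)).
  rewrite horner_prod; under eq_bigr do rewrite hornerXsubC.
  by move=> ->; apply: eq_bigr => j _; rewrite !mxE.
have dE : \det E = 1.
  rewrite det_trig; last first.
    by apply/is_trig_mxP => s j sj; rewrite mxE nth_default// sp.
  apply: big1 => s _; rewrite mxE.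
  by have /monicP := pm s; rewrite /lead_coef sp.
have dD : \det D = \prod_(i < n) i`!%:R.
  by rewrite det_diag; apply: eq_bigr => i _; rewrite mxE.
have dD0 : \det D != 0.
  rewrite dD; apply/prodf_neq0 => i _.
  by rewrite pnatr_eq0 -lt0n fact_gt0.
apply: (mulfI dD0); rewrite -det_mulmx DB det_mulmx dE mul1r det_Vandermonde dD.
rewrite big_split/= mulrCA -big_split/= [X in _ = _ * X]big1 ?mulr1.
  rewrite (exchange_big_dep predT)//=; apply: eq_bigr => i _.
  rewrite (big_ord_widen_cond n (fun=> true) (fun j => (a i)%:R - (a j)%:R))//=.
    by apply: eq_bigr => j _; rewrite !mxE.
  exact: ltnW.
by move=> i _; rewrite divff// pnatr_eq0 -lt0n fact_gt0.
Qed.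
End binomial_matrix.

Lemma sum_ord_trunc (V : nmodType) m n (f : nat -> V) : (m <= n)%N ->
  (forall j, (m <= j < n)%N -> f j = 0) -> \sum_(j < n) f j = \sum_(j < m) f j.
Proof.
move=> mn f0; rewrite -(big_mkord xpredT f) (big_cat_nat (n := m))//= big_mkord.
by rewrite [X in _ + X]big_nat [X in _ + X]big1 ?addr0.
Qed.

Section blocks.
Variable F : numFieldType.
Implicit Types U : {poly F}.

Lemma exprM_Xn U1 U2 m1 m2 a b :
  ('X^m1 * U1) ^+ a * ('X^m2 * U2) ^+ b =
  'X^(a * m1 + b * m2) * (U1 ^+ a * U2 ^+ b).
Proof. by rewrite !exprMn exprD [(a * _)%N]mulnC [(b * _)%N]mulnC !exprM; ring. Qed.

Lemma coef_monomial_lt U1 U2 m1 m2 a b r : (r < a * m1 + b * m2)%N ->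
  (('X^m1 * U1) ^+ a * ('X^m2 * U2) ^+ b)`_r = 0.
Proof. by move=> ra; rewrite exprM_Xn coefXnM ra. Qed.

Lemma coef_monomial_eq U1 U2 m1 m2 a b :
  (('X^m1 * U1) ^+ a * ('X^m2 * U2) ^+ b)`_(a * m1 + b * m2) =
  U1`_0 ^+ a * U2`_0 ^+ b.
Proof.
rewrite exprM_Xn coefXnM ltnn subnn coef0M; congr (_ * _).
  by elim: a => [|a IH]; rewrite ?coef1// !exprS coef0M IH.
by elim: b => [|b IH]; rewrite ?coef1// !exprS coef0M IH.
Qed.

(** Since m2 < m1, the order of the monomial increases with its exponent [a i]. Reading coefficients
    at these orders gives a triangular matrix with the lowest coefficients on the diagonal. *)
Lemma det_block_neq U1 U2 m1 m2 n t (a : nat -> nat) : (m2 < m1)%N ->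
  (forall i j, (i < j)%N -> (j < t)%N -> (a i < a j)%N) ->
  (forall i, (i < t)%N -> (a i <= n)%N) ->
  \det (\matrix_(s < t, i < t)
     (('X^m1 * U1) ^+ a i * ('X^m2 * U2) ^+ (n - a i))`_(a s * m1 + (n - a s) * m2))
  = \prod_(i < t) (U1`_0 ^+ a i * U2`_0 ^+ (n - a i)).
Proof.
move=> m21 amono an; rewrite det_trig.
  by apply: eq_bigr => i _; rewrite mxE coef_monomial_eq.
apply/is_trig_mxP => s i si; rewrite mxE coef_monomial_lt//.
have := amono _ _ si (ltn_ord i); have := an _ (ltn_ord i).
move: (a s) (a i) => x y yn xy.
have -> : (n - x = (n - y) + (y - x))%N by lia.
have -> : (y = x + (y - x))%N by lia.
by nia.
Qed.

(** With F2 = X^m U2 and H = X^(m+kappa) V, the monomial of exponent x is the sum over j of C(x,j)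
    mu^(x-j) F2^(n-j) H^j, and the j-th term has order mn + kappa j. The matrix is therefore a lower
    triangular one times the binomial matrix rescaled by powers of mu. *)
Lemma det_block_eq U2 (V : {poly F}) (mu : F) m kappa n t (a : nat -> nat) :
  (0 < kappa)%N -> mu != 0 -> (t <= n.+1)%N ->
  (forall i, (i < t)%N -> (a i <= n)%N) ->
  \det (\matrix_(s < t, i < t)
     ((mu *: ('X^m * U2) + 'X^(m + kappa) * V) ^+ a i
        * ('X^m * U2) ^+ (n - a i))`_(m * n + kappa * s))
  = \prod_(i < t) ((\prod_(j < i) ((a i)%:R - (a j)%:R)) / i`!%:R)
    * \prod_(i < t) (mu ^+ a i / mu ^+ i)
    * \prod_(i < t) (U2`_0 ^+ (n - i) * V`_0 ^+ i).
Proof.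
move=> k0 mu0 tn an.
set F2 := 'X^m * U2; set H := 'X^(m + kappa) * V.
pose f s x j := (F2 ^+ (n - j) * H ^+ j)`_(m * n + kappa * s)
   * (('C(x, j))%:R * mu ^+ (x - j)).
have fE s x : (s < t)%N -> (x <= n)%N ->
  ((mu *: F2 + H) ^+ x * F2 ^+ (n - x))`_(m * n + kappa * s) =
  \sum_(j < t) f s x j.
  move=> st xn; rewrite exprDn mulr_suml coef_sum.
  transitivity (\sum_(j < x.+1) f s x j).
    apply: eq_bigr => -[j /= jx] _; rewrite mulrnAl exprZn -!scalerAl.
    rewrite mulrAC -exprD (_ : x - j + (n - x) = n - j)%N; last by lia.
    by rewrite coefMn coefZ /f -mulr_natl; ring.
  (* The range of j must be the same for all columns. It is first enlarged to n, where the binomials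
     vanish, then cut at t, since for j ≥ t the order exceeds every index read. *)
  rewrite -(@sum_ord_trunc _ x.+1 n.+1)//; last first.
    by move=> j /andP[xj _]; rewrite /f bin_small// mul0r mulr0.
  apply: sum_ord_trunc => // j /andP[tj jn].
  rewrite /f coef_monomial_lt ?mul0r//.
  have -> : ((n - j) * m + j * (m + kappa) = m * n + kappa * j)%N by nia.
  by rewrite ltn_add2l ltn_mul2l k0 (leq_trans st).
pose L : 'M[F]_t :=
  \matrix_(s, j) (F2 ^+ (n - j) * H ^+ j)`_(m * n + kappa * s).
pose B : 'M[F]_t := \matrix_(s < t, i < t) ('C(a i, s))%:R.
pose D1 : 'M[F]_t := diag_mx (\row_(s < t) (mu ^+ s)^-1).
pose D2 : 'M[F]_t := diag_mx (\row_(s < t) mu ^+ a s).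
set A := (X in \det X).
have -> : A = L *m (D1 *m B *m D2).
  apply/matrixP => s i; rewrite [LHS]mxE fE ?an// mxE; apply: eq_bigr => j _.
  rewrite /f mul_mx_diag mul_diag_mx !mxE; congr (_ * _).
  (* For j > a i the truncated exponent differs from the quotient of powers of mu, but the binomial
     coefficient is then 0. *)
  case: (leqP j (a i)) => ji; first by rewrite expfB_cond ?(negPf mu0)//; ring.
  by rewrite bin_small// !(mul0r, mulr0).
rewrite !det_mulmx !det_diag det_binomial mulrC; congr (_ * _).
  rewrite mulrAC [RHS]mulrC -big_split/=; congr (_ * _).
  by apply: eq_bigr => i _; rewrite !mxE mulrC.
rewrite det_trig.
  apply: eq_bigr => i _; rewrite mxE.
  have -> : (m * n + kappa * i = (n - i) * m + i * (m + kappa))%N.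
    by have := ltn_ord i; nia.
  by rewrite coef_monomial_eq.
apply/is_trig_mxP => s i si; rewrite mxE coef_monomial_lt//.
have it := ltn_ord i.
have -> : ((n - i) * m + i * (m + kappa) = m * n + kappa * i)%N by nia.
by rewrite ltn_add2l ltn_mul2l k0.
Qed.
End blocks.

(** * Cauchy estimates for the Taylor coefficients of a rational function *)

Lemma le_geometric_limit (R : realType) (x B rho : R) (N : nat) :
  0 <= rho -> rho < 1 ->
  (\forall L \near \oo, x <= B * (1 + rho ^+ L) ^+ N) -> x <= B.
Proof.
move=> r0 r1 H.
have cv : (fun L : nat => B * (1 + rho ^+ L) ^+ N) @ \oo --> B.
  rewrite -[X in _ --> X]mulr1 -[X in _ * X](expr1n _ N) -[X in (X ^+ N)]addr0.
  apply: cvgM; first exact: cvg_cst.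
  apply: (@continuous_cvg _ _ _ _ _ _ (fun y : R => y ^+ N)).
    exact: exprn_continuous.
  apply: cvgD; first exact: cvg_cst.
  by apply: cvg_expr; rewrite ger0_norm.
rewrite -(cvg_lim (@Rhausdorff R) cv); apply: limr_ge => //.
by apply/cvg_ex; exists B.
Qed.

Section coefficients.
Variable C : numClosedFieldType.

Lemma sum_expr_unity_root (z : C) M : z ^+ M = 1 -> z != 1 ->
  \sum_(k < M) z ^+ k = 0.
Proof.
move=> zM z1; have := subrX1 z M.
rewrite zM subrr => /esym/eqP; rewrite mulf_eq0 subr_eq0 (negPf z1) /=.
by move/eqP.
Qed.

Lemma prim_root_exists M : (0 < M)%N -> exists w : C, M.-primitive_root w.
Proof.
move=> M0; have [r Er] := closed_field_poly_normal ('X^M - 1 : {poly C}).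
rewrite (monicP (monicXnsubC _ M0)) scale1r in Er.
have/hasP[w _ wM] : has M.-primitive_root r; last by exists w.
apply: has_prim_root => //.
- by apply/allP => z; rewrite -root_prod_XsubC -Er.
- rewrite -separable_prod_XsubC -Er separable_Xn_sub_1//.
  by rewrite pnatr_eq0 -lt0n.
- by rewrite -ltnS -(size_prod_XsubC r id) -Er size_XnsubC.
Qed.

(** Discrete Fourier inversion: with M larger than i and than the degree, the coefficient is the
    mean of p(w^k) w^(-ki) over the M-th roots of unity. *)
Lemma coef_le_circle (p : {poly C}) (B : C) i :
  (forall z, `|z| = 1 -> `|p.[z]| <= B) -> `|p`_i| <= B.
Proof.
move=> pB; set M := maxn (size p) i.+1.
have M0 : (0 < M)%N by rewrite leq_max orbT.
have iM : (i < M)%N by rewrite leq_max leqnn orbT.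
have [w wM] := prim_root_exists M0.
have w1 : `|w| = 1.
  apply/eqP; rewrite -(@pexpr_eq1 _ _ M)// -normrX (prim_expr_order wM).
  by rewrite normr1.
(* The exponent k(M - i) stands for -ki, as w^M = 1. *)
have E : \sum_(k < M) p.[w ^+ k] * w ^+ (k * (M - i)) = M%:R * p`_i.
  under eq_bigr => k _.
    rewrite (@horner_coef_wide _ M)// ?leq_maxl// mulr_suml.
    under eq_bigr => j _ do
      rewrite -mulrA -exprM -exprD -mulnDr mulnC exprM.
    over.
  rewrite exchange_big/=; under eq_bigr do rewrite -mulr_sumr.
  rewrite (bigD1 (Ordinal iM))//= subnKC; last exact: ltnW.
  have -> : \sum_(k < M) (w ^+ M) ^+ k = M%:R.
    under eq_bigr do rewrite (prim_expr_order wM) expr1n.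
    by rewrite sumr_const card_ord.
  rewrite mulrC big1 ?addr0// => j ji.
  rewrite sum_expr_unity_root ?mulr0//.
    by rewrite -exprM mulnC exprM (prim_expr_order wM) expr1n.
  apply: contra ji => /eqP h; apply/eqP/val_inj => /=.
  (* A multiple of M strictly between 0 and 2M can only be M itself, which forces j = i. *)
  have := prim_order_dvd wM (j + (M - i)); rewrite h eqxx => /dvdnP[q].
  have jM := ltn_ord j.
  case: q => [|[|q]]; [by lia| by lia|rewrite !mulSn; lia].
have : M%:R * `|p`_i| <= M%:R * B.
  rewrite -[X in X * _ <= _](normr_nat C M) -normrM -E.
  apply: le_trans (ler_norm_sum _ _ _) _.
  apply: le_trans (ler_sum _ (G := fun=> B) _) _ => [k _|].
    by rewrite normrM !normrX w1 !expr1n mulr1 pB// normrX w1 expr1n.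
  by rewrite sumr_const card_ord mulr_natl.
by rewrite ler_pM2l// ltr0n.
Qed.
End coefficients.

Section cauchy.
Local Open Scope complex_scope.
Local Open Scope ring_scope.
Variable R : realType.
Local Notation C := R[i].

(** For a root z of W, the factor X - z times a truncated geometric series is 1 - (X/z)^L, and |z| >
    1. So N counts the roots and [rho] bounds all the 1/|z|. Both are fixed before L, so that the
    bound on the circle tends to 1 as L grows. *)
Lemma near_one_multiple (W : {poly C}) :
  (forall z, `|z| <= 1 -> W.[z] != 0) ->
  exists rho : R, exists N : nat, [/\ 0 <= rho, rho < 1 &
    forall L, exists U T : {poly C}, W * U = 1 + 'X^L * T /\
      forall z, `|z| = 1 -> `|(W * U).[z]| <= (1 + rho%:C ^+ L) ^+ N].
Proof.
move=> W0.
have [r Wr] := closed_field_poly_normal W.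
have Wn0 : lead_coef W != 0.
  rewrite lead_coef_eq0; apply/eqP => Wz.
  by have := W0 0; rewrite normr0 ler01 Wz horner0 eqxx => /(_ isT).
have : all (fun z => 1 < `|z|) r.
  apply/allP => z zr; rewrite real_ltNge ?normr_real ?real1//.
  apply/negP => /W0; rewrite -[_ == 0]/(root W z) Wr rootZ//.
  by rewrite root_prod_XsubC zr.
rewrite Wr; set c := lead_coef W in Wn0 *; clearbody c; move=> {W Wr W0}.
elim: r => [_|z r IH /= /andP[z1 /IH[rho [N [r0 r1 H]]]]].
  exists 0, 0%N; split=> // L; exists (c^-1%:P), 0.
  rewrite big_nil alg_polyC -polyCM divff// mulr0 addr0; split=> // z _.
  by rewrite hornerE normr1 expr0.
have z0 : z != 0 by rewrite -normr_gt0 (lt_trans _ z1).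
have [rz Erz] : exists rz : R, `|z^-1| = rz%:C.
  by exists (complex.Re `|z^-1|); rewrite RRe_real// normr_real.
have rz0 : 0 <= rz by rewrite -lecR -Erz normr_ge0.
have rz1 : rz < 1 by rewrite -ltcR -Erz normfV invf_lt1// (lt_trans _ z1).
pose rho' := Num.max rho rz.
exists rho', N.+1; split; rewrite ?le_max ?r0// ?gt_max ?r1// => L.
have [U [T [UT UB]]] := H L.
pose U1 : {poly C} := - (z^-1)%:P * \sum_(k < L) ((z^-1)%:P * 'X) ^+ k.
have EU1 : ('X - z%:P) * U1 = 1 - (z^-1 ^+ L)%:P * 'X^L.
  rewrite /U1 mulrA.
  have -> : ('X - z%:P) * - (z^-1)%:P = 1 - (z^-1)%:P * 'X.
    by rewrite mulrN mulrBl opprB -polyCM divff// mulrC.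
  by rewrite -[RHS]opprB polyC_exp -exprMn subrX1 -[RHS]mulNr opprB.
exists (U * U1), (T - (z^-1 ^+ L)%:P * (1 + 'X^L * T)).
have -> : c *: (\prod_(z0 <- z :: r) ('X - z0%:P)) * (U * U1) =
    (c *: (\prod_(z0 <- r) ('X - z0%:P)) * U) * (('X - z%:P) * U1).
  by rewrite big_cons -!mul_polyC; ring.
split.
  by rewrite UT EU1; ring.
move=> w w1; rewrite hornerM normrM exprS mulrC.
apply: ler_pM => //.
  rewrite EU1 !hornerE; apply: le_trans (ler_normB _ _) _.
  rewrite normr1 normrM !normrX w1 expr1n mulr1 lerD2l Erz.
  by rewrite -!rmorphXn lecR lerXn2r ?nnegrE ?le_max ?lexx ?r0 ?orbT.
apply: le_trans (UB _ w1) _.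
rewrite -!rmorphXn -(rmorph1 (real_complex R)) -!rmorphD -!rmorphXn lecR.
have ? : 0 <= rho' by rewrite le_max r0.
rewrite lerXn2r ?nnegrE ?addr_ge0 ?exprn_ge0//.
by rewrite lerD2l lerXn2r ?nnegrE// le_max lexx.
Qed.

(* P * S agrees with P / W modulo 'X^L, so that this is Cauchy's estimate for
   the Taylor coefficients of P / W. *)
Lemma Cauchy_estimate (P W S T : {poly C}) (B : R) L i :
  (forall z, `|z| <= 1 -> W.[z] != 0) ->
  (forall z, `|z| = 1 -> `|P.[z]| <= B%:C * `|W.[z]|) ->
  W * S = 1 + 'X^L * T -> (i < L)%N -> `|(P * S)`_i| <= B%:C.
Proof.
move=> W0 PW WS iL.
have [rho [N [r0 r1 H]]] := near_one_multiple W0.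
have [x Ex] : exists x : R, `|(P * S)`_i| = x%:C.
  by exists (complex.Re `|(P * S)`_i|); rewrite RRe_real// normr_real.
rewrite Ex lecR; apply: (le_geometric_limit (rho := rho) (N := N)) => //.
exists L => // L' /= LL'; have [U [T' [WU UB]]] := H L'.
rewrite -lecR -Ex.
(* S and U both invert W, modulo X^L and X^L' respectively, so they agree modulo X^L. This lets L'
   go to infinity while the coefficient stays the same. *)
have -> : (P * S)`_i = (P * U)`_i.
  transitivity ((P * S * (W * U))`_i).
    by rewrite WU mulrDr mulr1 mulrCA coefD coefXnM (leq_trans iL)// addr0.
  have -> : P * S * (W * U) = P * U * (W * S) by ring.
  by rewrite WS mulrDr mulr1 mulrCA coefD coefXnM iL addr0.
apply: coef_le_circle => z z1.
have W0z : 0 < `|W.[z]| by rewrite normr_gt0 W0// z1.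
rewrite -(ler_pM2r W0z) -normrM -hornerM.
have -> : P * U * W = P * (W * U) by ring.
rewrite hornerM normrM rmorphM rmorphXn rmorphD rmorph1 rmorphXn/=.
rewrite mulrAC; apply: ler_pM => //; first exact: PW.
exact: UB.
Qed.

(* A zero z with |z| <= 1/4 costs a factor 4/3 in the bound for the quotient on
   the unit circle, and multiplying back by 'X - z gains 1/8 + 1/4 = 3/8 on the
   coefficients weighted by 8^-i: altogether 1/2 per zero. *)
Lemma coef_zeros (G W S T : {poly C}) (B : R) (s : seq C) L i :
  (forall z, `|z| <= 1 -> W.[z] != 0) ->
  (forall z, `|z| = 1 -> `|G.[z]| <= B%:C * `|W.[z]|) ->
  (forall z, z \in s -> `|z| <= 4^-1) ->
  \prod_(z <- s) ('X - z%:P) %| G ->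
  W * S = 1 + 'X^L * T -> (i < L)%N ->
  `|(G * S)`_i| <= B%:C * 2^-1 ^+ size s * 8 ^+ i.
Proof.
move=> W0 GW s4 /dvdpP[H GH] WS iL.
have Hi j : (j < L)%N -> `|(H * S)`_j| <= (B * (4 / 3) ^+ size s)%:C.
  apply: (Cauchy_estimate W0 _ WS) => z z1.
  have q1 : (3 / 4) ^+ size s <= `|(\prod_(z <- s) ('X - z%:P)).[z]|.
    elim: s s4 {GH} => [|a s IH] s4; first by rewrite big_nil hornerE normr1.
    rewrite big_cons hornerM normrM exprS.
    apply: ler_pM; rewrite ?exprn_ge0 ?divr_ge0//.
      rewrite hornerXsubC; apply: le_trans (lerB_dist _ _).
      rewrite z1; have := s4 a (mem_head _ _).
      rewrite -[X in is_true X -> _]subr_ge0 => h; rewrite -subr_ge0.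
      by have -> : 1 - `|a| - 3 / 4 = 4^-1 - `|a| by field.
    by apply: IH => b bs; apply: s4; rewrite in_cons bs orbT.
  rewrite rmorphM rmorphXn/= mulrAC.
  have := GW z z1; rewrite GH hornerM normrM => le.
  have e3 : (3 / 4 : C) ^+ size s * (4 / 3)%:C ^+ size s = 1.
    rewrite -exprMn fmorph_div/= !rmorph_nat.
    by rewrite (_ : 3 / 4 * (4 / 3) = 1) ?expr1n//; field.
  have p43 : 0 <= (4 / 3)%:C ^+ size s :> C.
    by apply: exprn_ge0; rewrite lecR divr_ge0.
  rewrite -[leLHS]mulr1 -e3 mulrA; apply: ler_wpM2r => //.
  by apply: le_trans le; apply: ler_wpM2l.
have step j : (j < L)%N -> `|(\prod_(z <- s) ('X - z%:P) * (H * S))`_j| <=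
   (B * (4 / 3) ^+ size s)%:C * (3 / 8) ^+ size s * 8 ^+ j.
  move: (B * _) Hi => K Hi; elim: s s4 j {GH} => [|a s IH] s4 j jL.
    rewrite big_nil mul1r expr0 mulr1; apply: le_trans (Hi _ jL) _.
    have K0 : 0 <= K%:C by apply: le_trans (Hi _ jL).
    by apply: ler_peMr => //; apply: exprn_ege1; rewrite (ler_nat _ 1 8).
  have {}IH := IH (fun b bs => s4 b (@mem_behead _ (a :: s) b bs)).
  have a4 := s4 a (mem_head _ _).
  rewrite big_cons -mulrA mulrBl coefB coefXM coefCM.
  apply: le_trans (ler_normB _ _) _; rewrite normrM.
  set D := \prod_(z <- s) ('X - z%:P) in IH *.
  have K0 : 0 <= K%:C by apply: le_trans (Hi _ jL).
  have a0 : `|a| * `|(D * (H * S))`_j| <=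
      4^-1 * (K%:C * (3 / 8) ^+ size s * 8 ^+ j) by apply: ler_pM => //; exact: IH.
  apply: le_trans (lerD (lexx _) a0) _.
  case: j => [|j] /= in jL a0 *.
    rewrite normr0 add0r !expr0 !mulr1 exprS [leRHS]mulrCA.
    apply: ler_wpM2r; first by rewrite mulr_ge0// exprn_ge0// divr_ge0.
    by rewrite -subr_ge0 (_ : _ - _ = 8^-1) ?invr_ge0//; field.
  apply: le_trans (lerD (IH _ (ltnW jL)) (lexx _)) _.
  rewrite !exprS le_eqVlt; apply/orP; left; apply/eqP; field.
  exact: isT.
have -> : G * S = \prod_(z <- s) ('X - z%:P) * (H * S).
  by rewrite GH mulrA [H * _]mulrC.
apply: le_trans (step _ iL) _.
rewrite rmorphM rmorphXn/= -[X in X * 8 ^+ _]mulrA -exprMn.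
rewrite fmorph_div/= !rmorph_nat.
by rewrite (_ : 4 / 3 * (3 / 8) = 2^-1)//; field.
Qed.
End cauchy.

(** * Counting zeros *)

Section counting.
Local Open Scope complex_scope.
Local Open Scope ring_scope.
Variable R : realType.
Local Notation C := R[i].

Lemma norm_modulus (z : C) : `|z| = (modulus z)%:C.
Proof. by []. Qed.

Lemma modulus_ge0 (z : C) : 0 <= modulus z.
Proof. by case: z => a b; exact: sqrtr_ge0. Qed.

Lemma modulusM (x y : C) : modulus (x * y) = modulus x * modulus y.
Proof. exact: ComplexField.Normc.normcM. Qed.

Lemma modulusX (x : C) k : modulus (x ^+ k) = modulus x ^+ k.
Proof.
elim: k => [|k IH]; first by rewrite !expr0 ComplexField.Normc.normc1.
by rewrite !exprS modulusM IH.
Qed.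

Lemma modulusV (x : C) : modulus x^-1 = (modulus x)^-1.
Proof. exact: ComplexField.Normc.normcV. Qed.

Lemma modulus_gt0 (x : C) : x != 0 -> 0 < modulus x.
Proof.
move=> x0; rewrite lt_neqAle modulus_ge0 andbT eq_sym.
by apply: contra x0 => /eqP/ComplexField.Normc.eq0_normc ->.
Qed.

Lemma zeros_count m (phi : 'I_m -> {poly C}) (W S T : {poly C}) L (r : 'I_m -> nat)
    N (x : 'cV[C]_m) (s : seq C) :
  let A := \matrix_(i, j) (phi j * S)`_(r i) in
  let G := \sum_j x j 0 *: phi j in
  (forall z, `|z| <= 1 -> W.[z] != 0) ->
  (forall j z, `|z| = 1 -> `|(phi j).[z]| <= `|W.[z]|) ->
  W * S = 1 + 'X^L * T ->
  (forall i, (r i <= N)%N) -> (N < L)%N ->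
  G != 0 -> \prod_(z <- s) ('X - z%:P) %| G ->
  (forall z, z \in s -> `|z| <= 4^-1) ->
  modulus (\det A) ^+ 2 <= m%:R ^+ m /\
  modulus (\det A) ^+ 2 * 4 ^+ size s <= m%:R ^+ m.+2 * 64 ^+ N.
Proof.
move=> A G W0 phiW WS rN NL G0 sG s4.
have A1 i j : `|A i j| <= 1.
  rewrite mxE -(rmorph1 (real_complex R)).
  apply: (Cauchy_estimate W0 _ WS) (leq_ltn_trans (rN i) NL) => z z1.
  by rewrite rmorph1 mul1r phiW.
split.
  rewrite -lecR rmorphXn/= -norm_modulus rmorphXn/= rmorph_nat.
  apply: le_trans (Hadamard A) _; rewrite -[X in _ ^+ X](card_ord m) -prodr_const.
  apply: ler_prod => i _; rewrite sumr_ge0//= -[X in _ <= X%:R](card_ord m).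
  rewrite -sumr_const; apply: ler_sum => j _.
  by rewrite exprn_ile1.
pose La : R := \sum_j modulus (x j 0).
have LaE : La%:C = \sum_j `|x j 0| by rewrite rmorph_sum.
have La0 : 0 < La.
  rewrite -ltcR LaE lt_neqAle sumr_ge0// andbT eq_sym.
  apply: contra G0; rewrite psumr_eq0// => /allP h.
  rewrite /G big1// => j _.
  by have := h j (mem_index_enum j); rewrite normr_eq0 => /eqP ->; rewrite scale0r.
have GW z : `|z| = 1 -> `|G.[z]| <= La%:C * `|W.[z]|.
  move=> z1; rewrite /G horner_sum LaE mulr_suml.
  apply: le_trans (ler_norm_sum _ _ _) _; apply: ler_sum => j _.
  by rewrite hornerZ normrM ler_wpM2l// phiW.
set Z := size s.
pose be : R := La * 2^-1 ^+ Z * 8 ^+ N.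
have bb i : `|(A *m x) i 0| <= be%:C.
  have -> : (A *m x) i 0 = (G * S)`_(r i).
    rewrite mxE /G mulr_suml coef_sum; apply: eq_bigr => j _.
    by rewrite mxE -scalerAl coefZ mulrC.
  apply: le_trans (coef_zeros W0 GW s4 sG WS (leq_ltn_trans (rN i) NL)) _.
  rewrite /be !rmorphM !rmorphXn fmorphV !rmorph_nat.
  apply: ler_wpM2l.
    by rewrite mulr_ge0 ?exprn_ge0 ?invr_ge0// LaE sumr_ge0.
  by rewrite ler_eXn2l// (ltr_nat _ 1 8).
have be0 : 0 <= be by rewrite !mulr_ge0 ?exprn_ge0 ?invr_ge0// ltW.
have cr j : modulus (x j 0) * modulus (\det A) <= Num.sqrt (m%:R ^+ m) * be.
  rewrite -(ler_pXn2r (n := 2))// ?nnegrE ?be0 ?mulr_ge0 ?be0 ?sqrtr_ge0 ?modulus_ge0 ?(ltW La0)//.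
  rewrite exprMn [leRHS]exprMn sqr_sqrtr ?exprn_ge0//.
  have := Cramer_bound A1 bb erefl j.
  rewrite (_ : m%:R ^+ m * be%:C ^+ 2 = (m%:R ^+ m * be ^+ 2)%:C); last first.
    by move: (be) => b; rewrite rmorphM !rmorphXn rmorph_nat.
  by move: (be) => b; rewrite !norm_modulus -rmorphM -rmorphXn lecR exprMn.
(* Summing Cramer's bound over j puts [La] on both sides, as [be] is proportional to it. It cancels
   after squaring, being positive because G is nonzero. *)
have : La * modulus (\det A) <= m%:R * (Num.sqrt (m%:R ^+ m) * be).
  rewrite mulr_suml; apply: le_trans (ler_sum _ (fun j _ => cr j)) _.
  by rewrite sumr_const card_ord mulr_natl.
move=> /(lerXn2r 2); rewrite !nnegrE.
have -> : 0 <= La * modulus (\det A) by rewrite mulr_ge0 ?modulus_ge0// ltW.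
have -> : 0 <= m%:R * (Num.sqrt (m%:R ^+ m) * be).
  by rewrite mulr_ge0 ?mulr_ge0 ?sqrtr_ge0 ?exprn_ge0 ?(ltW La0).
move=> /(_ isT isT); rewrite !exprMn sqr_sqrtr ?exprn_ge0// -!exprM => h.
rewrite -(ler_pM2l (exprn_gt0 2 La0)).
have e4 : 4 ^+ Z * (2^-1 ^+ (Z * 2) : R) = 1.
  rewrite mulnC exprM -exprMn (_ : 4 * 2^-1 ^+ 2 = 1) ?expr1n//.
  by rewrite expr2; field.
rewrite mulrA; apply: le_trans (ler_wpM2r _ h) _; first by rewrite exprn_ge0.
rewrite !exprS expr0 (_ : 8 ^+ (N * 2) = 64 ^+ N); last first.
  by rewrite mulnC exprM; congr (_ ^+ _); rewrite expr2 -natrM.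
rewrite le_eqVlt; apply/orP; left; apply/eqP.
rewrite [LHS](_ : _ = La * (La * 1) * (m%:R * (m%:R * m%:R ^+ m) * 64 ^+ N) *
  (4 ^+ Z * 2^-1 ^+ (Z * 2))); last by ring.
by rewrite e4 mulr1; ring.
Qed.

(** The inequality exp(-x) ≥ 1 - x at x = 3/20, raised to the fourth power, gives exp(-3/5) ≥
    1/2. *)
Lemma ln2_ge : (3 / 5 : R) <= ln 2.
Proof.
rewrite -[X in X <= _]expRK ler_ln ?posrE ?expR_gt0//.
have h : (17 / 20 : R) <= expR (- (3 / 20)).
  by apply: le_trans (expR_ge1Dx _); lra.
have h4 : (1 / 2 : R) <= expR (- (3 / 5)).
  have -> : - (3 / 5) = 4%:R * - (3 / 20) :> R by field.
  rewrite expRM_natl; apply: le_trans (_ : (17 / 20) ^+ 4 <= _).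
    by rewrite !exprS expr0; lra.
  by rewrite lerXn2r ?nnegrE ?expR_ge0//; lra.
rewrite -[leRHS]invrK -[leLHS]invrK lef_pV2 ?posrE ?invr_gt0 ?expR_gt0//.
by rewrite -expRN; lra.
Qed.

Lemma log_count_bound (m N Z : nat) (d : R) : (0 < m)%N -> 0 < d ->
  d ^+ 2 <= m%:R ^+ m -> d ^+ 2 * 4 ^+ Z <= m%:R ^+ m.+2 * 64 ^+ N ->
  Z%:R <= 5 * N.+1%:R * ln 2 + 5 * ln (m%:R `^ (m.+1%:R / 2) / d).
Proof.
move=> m0 d0 h1 h2; have c := ln2_ge.
have m0' : 0 < m%:R :> R by rewrite ltr0n.
have {h1} h1 : 2 * ln d <= m%:R * ln m%:R.
  by rewrite !mulr_natl -!lnXn// ler_ln// posrE exprn_gt0.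
have ln4 : ln (4 : R) = 2 * ln 2.
  have -> : (4 : R) = 2 ^+ 2 by ring.
  by rewrite lnXn// mulr_natl.
have ln64 : ln (64 : R) = 6 * ln 2.
  have -> : (64 : R) = 2 ^+ 6 by ring.
  by rewrite lnXn// mulr_natl.
have {h2} h2 : 2 * ln d + Z%:R * (2 * ln 2) <= m.+2%:R * ln m%:R + N%:R * (6 * ln 2).
  rewrite -ln4 -ln64 !mulr_natl -!lnXn//.
  by rewrite -!lnM ?posrE ?exprn_gt0// ler_ln// posrE;
    apply: mulr_gt0; rewrite exprn_gt0.
rewrite ln_div ?posrE ?powR_gt0 ?ln_powR//.
move: h1 h2; rewrite -[N.+1%:R]natr1 -[m.+2%:R]natr1 -[m.+1%:R]natr1.
have : 0 <= ln m%:R :> R by rewrite ln_ge0// ler1n.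
have : 0 <= N%:R :> R by [].
have : 0 <= Z%:R :> R by [].
move: c {ln4 ln64 m0'}; move: (m%:R : R) => x.
move: (ln x) (ln d) (ln (2 : R)) (N%:R : R) (Z%:R : R) => l D c n z hc z0 n0 l0 h1 h2.
set y := (x + 1) / 2 * l - D.
have y0 : 0 <= y by rewrite /y; nra.
(* Besides 2y, the second hypothesis leaves a term l = log m; the first one gives l ≤ 2y. It remains
   to use 3 ≤ 5c and 2 ≤ 5c. *)
have : z * c <= 3 * n * c + 2 * y by rewrite /y; nra.
nra.
Qed.

(** Counts bounded by the integer part of B attain a maximum. The bound is part of [P] so that the
    maximum inherits it. *)
Lemma max_nb_zeros_exists (I : Type) (g : I -> C -> C) (adm : set I) (A : set C) (B : R) :
  adm !=set0 ->
  (forall lam, adm lam -> exists2 N, nb_zeros (g lam) A N & N%:R <= B) ->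
  exists2 Z, max_nb_zeros g adm A Z & Z%:R <= B.
Proof.
move=> [l0 l0adm] H.
pose P N := `[< exists lam, [/\ adm lam, nb_zeros (g lam) A N & N%:R <= B] >].
have exP : exists N, P N.
  by have [N gN NB] := H _ l0adm; exists N; apply/asboolP; exists l0.
have ubP N : P N -> (N <= Num.truncn B)%N.
  by move=> /asboolP[lam [_ _ NB]]; rewrite -(@natrK R N) le_truncn.
case: (ex_maxnP exP ubP) => Z /asboolP[lam [lamadm gZ ZB]] Zmax.
exists Z => //; split; first by exists lam.
move=> mu mua; have [N gN NB] := H _ mua; exists N => //.
by apply: Zmax; apply/asboolP; exists mu.
Qed.

End counting.

(** * Zeros of a quotient of polynomials *)

Section zeros.
Local Open Scope complex_scope.
Local Open Scope ring_scope.
Variable R : realType.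
Local Notation C := R[i].

Lemma derivable_poly (p : {poly C}) (z : C) :
  derivable (horner p : C^o -> C^o) z 1.
Proof.
elim/poly_ind: p => [|p c IH].
  by rewrite (_ : horner 0 = cst 0); [exact: derivable_cst|apply/funext => y; rewrite horner0].
rewrite (_ : horner _ = ((horner p : C^o -> C^o) * id + cst c)).
  apply: derivableD; last exact: derivable_cst.
  by apply: derivableM; [exact: IH|exact: derivable_id].
by apply/funext => y; rewrite hornerMXaddC.
Qed.

Lemma near_horner_neq0 (p : {poly C}) (z : C) : p.[z] != 0 ->
  \forall y \near (z : C^o), p.[y] != 0.
Proof.
move=> pz.
have /derivable1_diffP/differentiable_continuous cp := @derivable_poly p z.
exact: (cvgr_neq0 _ cp pz).
Qed.

(** The list consists of the roots of G in the disc. At a point z of the disc, the product of the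
    factors of G at the other roots, divided by V^d, is the holomorphic nonvanishing cofactor; if z
    is not a root, the multiplicity is 0. *)
Lemma nb_zeros_ratio (G V : {poly C}) (d : nat) (g : C -> C) (r : R) :
  G != 0 -> (forall z, closed_disc r z -> V.[z] != 0) ->
  (forall z, V.[z] != 0 -> g z = G.[z] / (V ^+ d).[z]) ->
  exists s : seq C, [/\ \prod_(z <- s) ('X - z%:P) %| G,
    forall z, z \in s -> closed_disc r z & nb_zeros g (closed_disc r) (size s)].
Proof.
move=> G0 V0 gE.
have W0 z : V.[z] != 0 -> (V ^+ d).[z] != 0 by rewrite horner_exp => /expf_neq0.
have [t Gt] := closed_field_poly_normal G.
pose s := [seq z <- t | modulus z <= r].
have sr z : z \in s -> closed_disc r z by rewrite mem_filter => /andP[].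
exists s; split=> //.
  rewrite Gt dvdpZr ?lead_coef_eq0//.
  have -> : \prod_(z <- t) ('X - z%:P) = \prod_(z <- s) ('X - z%:P) *
      \prod_(z <- t | ~~ (modulus z <= r)) ('X - z%:P).
    by rewrite (bigID (fun z => modulus z <= r))/= big_filter.
  exact: dvdp_mulr.
exists s; split=> // z zr; set k := count_mem z s.
pose H := lead_coef G *: \prod_(y <- t | y != z) ('X - y%:P).
have GH : G = ('X - z%:P) ^+ k * H.
  rewrite {1}Gt /H -scalerAr; congr (_ *: _).
  rewrite (bigID (pred1 z))/=; congr (_ * _).
  rewrite (eq_bigr (fun=> 'X - z%:P)); last by move=> y /eqP ->.
  rewrite big_const_seq iter_mulr_1; congr (_ ^+ _).
  rewrite /k /s count_filter; apply: eq_count => y /=.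
  by case: eqP => // ->; rewrite /closed_disc/= in zr; rewrite zr.
have Hz : H.[z] != 0.
  rewrite /H hornerZ mulf_neq0 ?lead_coef_eq0// horner_prod.
  rewrite prodf_seq_neq0; apply/allP => y _; apply/implyP => yz.
  by rewrite hornerXsubC subr_eq0 eq_sym.
have nV := near_horner_neq0 (V0 _ zr).
exists (fun y => H.[y] / (V ^+ d).[y]); split.
- apply: filterS nV => y Vy.
  apply: (@derivableM _ _ (horner H : C^o -> C^o) (fun y => ((V ^+ d).[y])^-1 : C^o)).
    exact: derivable_poly.
  by apply: derivableV; [exact: W0|exact: derivable_poly].
- by rewrite mulf_neq0 ?invr_eq0 ?W0 ?V0.
- by apply: filterS nV => y Vy; rewrite gE// {1}GH hornerM horner_exp hornerXsubC mulrA.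
Qed.

(** The points 1/(k+1) lie in the disc and outnumber the roots. This turns a nonzero numerator into
    an admissible parameter. *)
Lemma horner_neq0_disc (G : {poly C}) : G != 0 ->
  exists2 z, closed_disc 1 z & G.[z] != 0.
Proof.
move=> G0; apply: contrapT => h.
pose s : seq C := [seq k.+1%:R^-1 | k <- iota 0 (size G)].
have us : uniq s.
  rewrite map_inj_uniq ?iota_uniq// => a b /invr_inj/eqP.
  by rewrite eqr_nat => /eqP[].
have as_ : all (root G) s.
  apply/allP => _ /mapP[k _ ->]; apply: contrapT => /negP Gk.
  apply: h; exists (k.+1%:R^-1) => //=.
  by rewrite /closed_disc/= -lecR -(@norm_modulus R k.+1%:R^-1) normfV normr_nat rmorph1
    invf_le1 ?ltr0n ?ler1n.
by have := max_poly_roots G0 as_ us; rewrite size_map size_iota ltnn.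
Qed.
End zeros.

Lemma monomial_ratio (F : fieldType) (l p q x y z : F) : x != 0 -> y != 0 -> z != 0 ->
  l * (p / z) * (q / y) = l * p * q * x / (x * (y * z)).
Proof. by move=> x0 y0 z0; field; rewrite x0 y0 z0. Qed.

Lemma monomial_le (F : numDomainType) (p q v : F) a b c : 0 <= p -> 0 <= q ->
  p <= v -> q <= v -> p ^+ a * q ^+ b * v ^+ c <= v ^+ a * v ^+ b * v ^+ c.
Proof.
move=> p0 q0 pv qv; have v0 := le_trans p0 pv.
apply: ler_wpM2r; first exact: exprn_ge0.
by apply: ler_pM; rewrite ?exprn_ge0// lerXn2r.
Qed.

(** * From block determinants to the bound on the number of zeros *)

Section assembly.
Local Open Scope complex_scope.
Local Open Scope ring_scope.
Variable R : realType.
Local Notation C := R[i].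
Implicit Types P V w : {poly C}.

Lemma exp_one_mod (F : fieldType) (T : {poly F}) L k :
  exists T' : {poly F}, (1 + 'X^L * T) ^+ k = 1 + 'X^L * T'.
Proof.
elim: k => [|k [T' IH]]; first by exists 0; rewrite expr0 mulr0 addr0.
exists (T' + T + 'X^L * T * T'); rewrite exprS IH; ring.
Qed.

Lemma big_tagnat (S : Type) (idx : S) (op : Monoid.com_law idx) p (p_ : 'I_p -> nat)
    (f : forall l, 'I_(p_ l) -> S) :
  \big[op/idx]_(k < \sum_l p_ l) f (tagnat.sig1 k) (tagnat.sig2 k) =
  \big[op/idx]_l \big[op/idx]_(i < p_ l) f l i.
Proof.
by rewrite sig_big_dep/= (reindex _ tagnat.sig_bij_on).
Qed.

Variables (P1 P2 V : {poly C}) (ld : nat) (n : 'I_ld.+1 -> nat) (T : 'I_ld.+1 -> seq nat).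
Hypothesis hdef : forall z, closed_disc 1 z -> V.[z] != 0.
Hypothesis hbd1 : forall z, closed_disc 1 z -> modulus (P1.[z] / V.[z]) <= 1.
Hypothesis hbd2 : forall z, closed_disc 1 z -> modulus (P2.[z] / V.[z]) <= 1.
Hypothesis hT : lacunary_family n T.

Let d := n ord_max.
Local Notation a l i := (t_ T l i).-1.
Local Notation m := (nb_param T).

Lemma lacunary_n_le l : (n l <= d)%N.
Proof.
have [nmono _] := hT.
case: (ltngtP l (@ord_max ld)) => h; first exact/ltnW/nmono.
  by have := ltn_ord l; rewrite leqNgt ltnS h.
by rewrite /d (_ : l = ord_max)//; apply/val_inj.
Qed.

Lemma lacunary_t_bounds l i : (i < tau T l)%N -> (1 <= t_ T l i <= (n l).+1)%N.
Proof. by have [_ /(_ l)[_ _ /all_nthP]] := hT; apply. Qed.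

Lemma lacunary_a_le l i : (i < tau T l)%N -> (a l i <= n l)%N.
Proof. by move=> /lacunary_t_bounds; lia. Qed.

(** The power of V puts all monomials in P1/V and P2/V over the common denominator V^d. *)
Definition numer l i : {poly C} := P1 ^+ a l i * P2 ^+ (n l - a l i) * V ^+ (d - n l).

Definition numer_sum (lam : param T C) : {poly C} :=
  \sum_l \sum_(i < tau T l) lam l i *: numer l i.

Lemma g_ratio (lam : param T C) z : V.[z] != 0 ->
  g_ n P1 P2 V lam z = (numer_sum lam).[z] / (V ^+ d).[z].
Proof.
move=> Vz; rewrite /g_ /Qeval /Q /numer_sum !horner_sum mulr_suml.
apply: eq_bigr => l _; rewrite !horner_sum mulr_suml.
apply: eq_bigr => i _; rewrite /numer !hornerE/=.
have an := lacunary_a_le (ltn_ord i); have nd := lacunary_n_le l.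
have -> : V.[z] ^+ d = V.[z] ^+ (d - n l) * (V.[z] ^+ (n l - a l i) * V.[z] ^+ a l i).
  by rewrite -!exprD; congr (_ ^+ _); lia.
rewrite !expr_div_n; apply: monomial_ratio; exact: expf_neq0.
Qed.

Lemma numer_bound l i (z : C) : (i < tau T l)%N -> `|z| = 1 ->
  `|(numer l i).[z]| <= `|(V ^+ d).[z]|.
Proof.
move=> it z1; have an := lacunary_a_le it; have nd := lacunary_n_le l.
have zd : closed_disc 1 z by rewrite /closed_disc/= -lecR -(norm_modulus z) z1.
have bd P : modulus (P.[z] / V.[z]) <= 1 -> `|P.[z]| <= `|V.[z]|.
  rewrite -lecR -(norm_modulus (P.[z] / V.[z])) normf_div rmorph1 ler_pdivrMr ?mul1r//.
  by rewrite normr_gt0 hdef.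
rewrite /numer !hornerM !horner_exp !normrM !normrX.
have -> : `|V.[z]| ^+ d =
    `|V.[z]| ^+ a l i * `|V.[z]| ^+ (n l - a l i) * `|V.[z]| ^+ (d - n l).
  by rewrite -!exprD; congr (_ ^+ _); lia.
by apply: monomial_le; rewrite // bd ?hbd1 ?hbd2.
Qed.

Definition block w (r : 'I_ld.+1 -> nat -> nat) l l' : 'M[C]_(tau T l, tau T l') :=
  \matrix_(s, i) ((P1 * w) ^+ a l' i * (P2 * w) ^+ (n l' - a l' i))`_(r l s).

(** The two cases differ only in the indices [r] and the block determinants [Dl]. The hypothesis
    ranges over all inverses w of V modulo X^(N+1), since w is only produced inside the proof. *)
Lemma max_nb_zeros_bound (r : 'I_ld.+1 -> nat -> nat) (N : nat) (Dl : 'I_ld.+1 -> C) :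
  (0 < m)%N ->
  (forall l i, (i < tau T l)%N -> (r l i <= N)%N) ->
  (forall w (Tw : {poly C}), V * w = 1 + 'X^(N.+1) * Tw ->
     (forall l, \det (block w r l l) = Dl l) /\
     (forall l l' : 'I_ld.+1, (l < l')%N -> block w r l l' = 0)) ->
  (forall l, Dl l != 0) ->
  exists2 Z, max_nb_zeros (fun lam : param T C => g_ n P1 P2 V lam)
      [set lam | exists2 z, closed_disc 1 z & g_ n P1 P2 V lam z != 0]
      (closed_disc 4^-1) Z
    & Z%:R <= 5 * N.+1%:R * ln 2
        + 5 * ln (m%:R `^ (m.+1%:R / 2) / modulus (\prod_l Dl l)).
Proof.
move=> m0 rN hblk Dl0.
have V0 (z : C) : `|z| <= 1 -> V.[z] != 0.
  by move=> z1; apply: hdef; rewrite /closed_disc/= -lecR.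
have W0 (z : C) : `|z| <= 1 -> (V ^+ d).[z] != 0.
  by move=> z1; rewrite horner_exp expf_neq0// V0.
have [_ [_ [_ _ /(_ N.+1)[w [Tw [Vw _]]]]]] := near_one_multiple V0.
have [dB B0] := hblk _ _ Vw.
have [T' WS] : exists T' : {poly C}, V ^+ d * w ^+ d = 1 + 'X^(N.+1) * T'.
  by rewrite -exprMn Vw; exact: exp_one_mod.
pose rr (k : 'I_m) := r (tagnat.sig1 k) (tagnat.sig2 k).
pose phi (k : 'I_m) := numer (tagnat.sig1 k) (tagnat.sig2 k).
pose A : 'M[C]_m := \matrix_(i, j) (phi j * w ^+ d)`_(rr i).
have rrN k : (rr k <= N)%N by apply: rN; exact: ltn_ord.
(* In [numer l i * w ^+ d] the factor (V w)^(d - n l) splits off; it is 1 modulo X^(N+1), hence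
   invisible at indices up to N. *)
have AE : A = \mxblock_(l, l') block w r l l'.
  apply/matrixP => i j; rewrite !mxE /phi /numer.
  set l := tagnat.sig1 j; set e := a l _.
  have an : (e <= n l)%N by apply: lacunary_a_le; exact: ltn_ord.
  have nd := lacunary_n_le l.
  have [T2 E2] := exp_one_mod Tw N.+1 (d - n l).
  rewrite -[X in w ^+ X](subnK nd) exprD.
  rewrite (_ : _ * _ = (P1 ^+ e * P2 ^+ (n l - e) * w ^+ n l) * (V * w) ^+ (d - n l)).
    rewrite Vw E2 mulrDr mulr1 mulrCA coefD coefXnM ltnS rrN addr0.
    rewrite -[X in w ^+ X](subnKC an) exprD !exprMn.
    by rewrite mulrACA.
  by rewrite exprMn [in RHS]mulrACA [w ^+ n l * _]mulrC.
have dA : \det A = \prod_l Dl l.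
  rewrite AE det_mxblock_ltrig => [|l l' ll']; last exact: B0.
  by apply: eq_bigr => l _; rewrite dB.
have dA0 : \det A != 0 by rewrite dA; apply/prodf_neq0 => l _; exact: Dl0.
pose x (lam : param T C) : 'cV[C]_m := \col_k lam (tagnat.sig1 k) (tagnat.sig2 k).
have GE lam : numer_sum lam = \sum_j x lam j 0 *: phi j.
  rewrite /numer_sum -big_tagnat; apply: eq_bigr => k _.
  by rewrite mxE.
have phiW j (z : C) : `|z| = 1 -> `|(phi j).[z]| <= `|(V ^+ d).[z]|.
  by move=> z1; apply: numer_bound => //; exact: ltn_ord.
have NN : (N < N.+1)%N by [].
apply: max_nb_zeros_exists.
  (* Some parameter must be admissible. As det A is nonzero, the numerators are linearly
     independent, and any nonzero parameter will do. *)
  pose lam1 : param T C := fun _ _ => 1.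
  have G0 : numer_sum lam1 != 0.
    apply/negP => /eqP G0.
    have : A *m x lam1 = 0.
      apply/matrixP => i j; rewrite !mxE.
      transitivity ((numer_sum lam1 * w ^+ d)`_(rr i)); last by rewrite G0 mul0r coef0.
      rewrite GE mulr_suml coef_sum; apply: eq_bigr => k _.
      by rewrite !mxE -scalerAl coefZ mulrC.
    move=> /(congr1 (mulmx (invmx A))); rewrite mulKmx ?unitmxE ?unitfE// mulmx0.
    by move/matrixP/(_ (Ordinal m0) 0); rewrite !mxE => /eqP; rewrite oner_eq0.
  have [z z1 Gz] := horner_neq0_disc G0.
  exists lam1; exists z => //; rewrite g_ratio ?hdef// mulf_neq0// invr_eq0 W0//.
  by rewrite norm_modulus -(rmorph1 (real_complex R)) lecR.
move=> lam [z z1 gz].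
have G0 : numer_sum lam != 0.
  by apply: contra gz => /eqP G0; rewrite g_ratio ?hdef// G0 horner0 mul0r.
have le41 (y : C) : closed_disc 4^-1 y -> closed_disc 1 y.
  by move=> /le_trans; apply; lra.
have [s [sG s4 Ns]] : exists s : seq C, [/\ \prod_(z <- s) ('X - z%:P) %| numer_sum lam,
    forall z, z \in s -> closed_disc 4^-1 z
    & nb_zeros (g_ n P1 P2 V lam) (closed_disc 4^-1) (size s)].
  apply: (nb_zeros_ratio (V := V) (d := d)) => // [y /le41 /hdef//|y].
  exact: g_ratio.
exists (size s) => //; rewrite -dA.
have s4' (y : C) : y \in s -> `|y| <= 4^-1.
  by move=> /s4 zs; rewrite norm_modulus -(rmorph_nat (real_complex R)) -fmorphV lecR.
have sG' : \prod_(z <- s) ('X - z%:P) %| \sum_j x lam j 0 *: phi j by rewrite -GE.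
have G0' : \sum_j x lam j 0 *: phi j != 0 by rewrite -GE.
have [h1 h2] := zeros_count W0 phiW WS rrN NN G0' sG' s4'.
apply: log_count_bound h1 h2 => //.
exact: modulus_gt0.
Qed.
End assembly.

(** * Lacunarity and exponents *)

Lemma lacunary_chain ld (u v : 'I_ld.+1 -> nat) :
  (forall l, (u l <= v l)%N) ->
  (forall l l' : 'I_ld.+1, l' = l.+1 :> nat -> (v l < u l')%N) ->
  forall l l' : 'I_ld.+1, (l < l')%N -> (v l < u l')%N.
Proof.
move=> uv vu l l'; move Eb : (nat_of_ord l') => b.
elim: b => [//|b IH] in l l' Eb *; rewrite ltnS leq_eqVlt => /orP[/eqP lb|lb].
  by apply: vu; rewrite Eb lb.
have bl : (b < ld.+1)%N by have := ltn_ord l'; lia.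
have := IH l (Ordinal bl) erefl lb => /leq_trans; apply.
by apply: leq_trans (uv _) _; apply/ltnW/vu; rewrite Eb.
Qed.

Lemma lacunary_le_max ld (u v : 'I_ld.+1 -> nat) :
  (forall l, (u l <= v l)%N) ->
  (forall l l' : 'I_ld.+1, l' = l.+1 :> nat -> (v l < u l')%N) ->
  forall l, (v l <= v ord_max)%N.
Proof.
move=> uv vu l; case: (ltngtP l (@ord_max ld)) => h.
- exact: ltnW (leq_trans (lacunary_chain uv vu h) (uv _)).
- by have := ltn_ord l; rewrite leqNgt ltnS h.
- by rewrite (_ : l = ord_max)//; apply/val_inj.
Qed.

Section valuation.
Variable F : fieldType.
Implicit Types P V w p : {poly F}.

Lemma val0_factor P : P != 0 ->
  exists p, [/\ P = 'X^(val0 P) * p, forall i, p`_i = redcoef P i & redcoef P 0 != 0].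
Proof.
move=> P0; have /dvdpP[p Pp] : 'X^(val0 P) %| P.
  by have := mup_geq 0 (val0 P) P0; rewrite leqnn subr0 => <-.
exists p; have pE i : p`_i = redcoef P i.
  by rewrite /redcoef {1}Pp coefMXn ltnNge leq_addr/= addKn.
split; [by rewrite mulrC|exact: pE|rewrite -pE; apply/negP => /eqP p0].
have : ('X - 0%:P) ^+ (val0 P).+1 %| P.
  rewrite subr0 exprS {2}Pp dvdp_mul//.
  by rewrite -['X]subr0 dvdp_XsubCl rootE horner_coef0 p0.
by rewrite -mup_geq// ltnn.
Qed.

Lemma val0_le_deg P : P != 0 -> (val0 P <= deg P)%N.
Proof.
move=> P0; have [p [Pp _ _]] := val0_factor P0.
have p0 : p != 0 by apply: contraNneq P0 => p0; rewrite Pp p0 mulr0.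
rewrite /deg {2}Pp mulrC size_mulXn// polySpred// addnS/=.
exact: leq_addr.
Qed.

Lemma coef0_inverse V w T N : V * w = 1 + 'X^(N.+1) * T -> w`_0 = V.[0]^-1.
Proof.
move=> /(congr1 (fun p => p`_0)); rewrite coefD coefXnM coef0M coef1 addr0/= => h.
have V0 : V`_0 != 0 by apply: contraPneq h => ->; rewrite mul0r => /esym/eqP; rewrite oner_eq0.
by rewrite horner_coef0; apply: (mulfI V0); rewrite h divff.
Qed.

(** The diagonal blocks involve w only through this constant coefficient, so their determinants are
    the same for every w. *)
Lemma coef0_mul_inverse V w T N p : V * w = 1 + 'X^(N.+1) * T ->
  (p * w)`_0 = p`_0 / V.[0].
Proof. by move=> /coef0_inverse h; rewrite coef0M h. Qed.

Lemma polyXn_factor p N : (forall i, (i < N)%N -> p`_i = 0) ->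
  p = 'X^N * drop_poly N p.
Proof.
move=> p0; rewrite -[LHS](poly_take_drop N) mulrC.
suff -> : take_poly N p = 0 by rewrite add0r.
by apply/polyP => i; rewrite coef_take_poly coef0; case: ifP => // /p0.
Qed.

Lemma delta_neq0 P1 P2 k : agree_max P1 P2 k -> delta P1 P2 k != 0.
Proof.
move=> [agk maxk]; apply/negP => /eqP d0.
have /maxk : agree P1 P2 k.+1; last by rewrite ltnn.
move=> i; rewrite leq_eqVlt => /orP[/eqP ->|]; last exact: agk.
by apply/eqP; rewrite -subr_eq0; apply/eqP.
Qed.

(** Since [delta] is nonzero, P1 or P2 has a nonzero coefficient of index ν+k+1. This lets the first
    lacunarity condition imply the second. *)
Lemma delta_le_deg P1 P2 k : agree_max P1 P2 k -> val0 P1 = val0 P2 ->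
  (val0 P2 + k.+1 <= maxn (deg P1) (deg P2))%N.
Proof.
move=> /delta_neq0 d0 e; rewrite leqNgt; apply: contra d0.
rewrite gtn_max /deg => /andP[h1 h2].
have s1 : (size P1 <= val0 P2 + k.+1)%N by rewrite (leq_trans (leqSpred _)).
have s2 : (size P2 <= val0 P2 + k.+1)%N by rewrite (leq_trans (leqSpred _)).
by rewrite /delta /redcoef e !nth_default// mulr0 subr0.
Qed.
End valuation.

Section lists.
Variables (ld : nat) (n : 'I_ld.+1 -> nat) (T : 'I_ld.+1 -> seq nat).
Hypothesis hT : lacunary_family n T.
Local Notation a l i := (t_ T l i).-1.

Lemma tau_gt0 l : (0 < tau T l)%N.
Proof. by have [_ /(_ l)[]] := hT; rewrite /tau; case: (T l). Qed.

Lemma tau_le l : (tau T l <= (n l).+1)%N.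
Proof.
have [_ /(_ l)[_ st /allP h]] := hT.
rewrite -(size_iota 1 (n l).+1); apply: uniq_leq_size.
  by apply: sorted_uniq st; [exact: ltn_trans|exact: ltnn].
by move=> t /h; rewrite mem_iota add1n ltnS.
Qed.

Lemma t_lt l i j : (i < j)%N -> (j < tau T l)%N -> (t_ T l i < t_ T l j)%N.
Proof.
have [_ /(_ l)[_ st _]] := hT => ij jt.
exact: (sorted_ltn_nth ltn_trans 0%N st i j (ltn_trans ij jt) jt).
Qed.

Lemma a_lt l i j : (i < j)%N -> (j < tau T l)%N -> (a l i < a l j)%N.
Proof.
move=> ij jt; have := t_lt ij jt.
have := lacunary_t_bounds hT (ltn_trans ij jt); lia.
Qed.

Lemma a_le l i j : (i <= j)%N -> (j < tau T l)%N -> (a l i <= a l j)%N.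
Proof. by rewrite leq_eqVlt => /orP[/eqP ->//|/a_lt h /h /ltnW]. Qed.

Lemma sum_a : (\sum_l \sum_(i < tau T l) a l i + nb_param T = t_bar T)%N.
Proof.
rewrite /nb_param -big_split/=; apply: eq_bigr => l _.
rewrite -[in X in (_ + X)%N](card_ord (tau T l)) -sum1_card -big_split/=.
apply: eq_bigr => i _; have := lacunary_t_bounds hT (ltn_ord i); lia.
Qed.

Lemma sum_n_a : (\sum_l \sum_(i < tau T l) (n l - a l i) + \sum_l \sum_(i < tau T l) a l i
  = taun_bar n T)%N.
Proof.
rewrite -big_split/=; apply: eq_bigr => l _; rewrite -big_split/=.
rewrite -[in RHS](card_ord (tau T l)) -sum_nat_const; apply: eq_bigr => i _.
by rewrite subnK// lacunary_a_le.
Qed.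

Lemma sum_n_i : (\sum_l \sum_(i < tau T l) (n l - i) + \sum_l \sum_(i < tau T l) i
  = taun_bar n T)%N.
Proof.
rewrite -big_split/=; apply: eq_bigr => l _; rewrite -big_split/=.
rewrite -[in RHS](card_ord (tau T l)) -sum_nat_const; apply: eq_bigr => i _.
by rewrite subnK//; have := tau_le l; have := ltn_ord i; lia.
Qed.

Lemma sum_i : (\sum_l \sum_(i < tau T l) i = tau_bar' T)%N.
Proof.
apply: eq_bigr => l _; rewrite -(big_mkord xpredT (fun i => i)) bin2_sum bin2.
by rewrite divn2.
Qed.

Lemma tau_barE : (tau_bar T = tau_bar' T + nb_param T)%N.
Proof.
rewrite -big_split/=; apply: eq_bigr => l _; have := tau_gt0 l.
move: (tau T l) => t t0; rewrite (_ : t * t.+1 = t * 2 + t * t.-1)%N; last by nia.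
by rewrite divnMDl// addnC.
Qed.
End lists.

Section determinant_value.
Local Open Scope complex_scope.
Local Open Scope ring_scope.
Variables (R : realType) (ld : nat) (n : 'I_ld.+1 -> nat) (T : 'I_ld.+1 -> seq nat).
Hypothesis hT : lacunary_family n T.
Local Notation C := R[i].
Local Notation a l i := (t_ T l i).-1.

Lemma prod_powers (x : C) (f : forall l, nat -> nat) :
  \prod_(l < ld.+1) \prod_(i < tau T l) x ^+ f l i =
  x ^+ (\sum_(l < ld.+1) \sum_(i < tau T l) f l i)%N.
Proof. by rewrite expr_sum; apply: eq_bigr => l _; rewrite expr_sum. Qed.

Lemma C_bar_gt0 : 0 < C_bar T R.
Proof.
apply: prodr_gt0 => l _; apply: prodr_gt0 => i _.
rewrite divr_gt0 ?ltr0n ?fact_gt0//; apply: prodr_gt0 => j _.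
by rewrite subr_gt0 ltr_nat (t_lt hT).
Qed.

Lemma C_barE : \prod_l \prod_(i < tau T l)
   ((\prod_(j < i) ((a l i)%:R - (a l j)%:R)) / i`!%:R) = (C_bar T R)%:C.
Proof.
rewrite rmorph_prod; apply: eq_bigr => l _; rewrite rmorph_prod; apply: eq_bigr => i _.
rewrite fmorph_div rmorph_nat rmorph_prod; congr (_ / _); apply: eq_bigr => j _.
rewrite rmorphB !rmorph_nat.
have /prednK {2}<- : (0 < t_ T l i)%N.
  by have /andP[] := lacunary_t_bounds hT (ltn_ord i).
have /prednK {2}<- : (0 < t_ T l j)%N.
  by have /andP[] := lacunary_t_bounds hT (ltn_trans (ltn_ord j) (ltn_ord i)).
by rewrite -!natr1; ring.
Qed.

Lemma expfz_nat (x : R) (p q : nat) : x != 0 ->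
  x ^ (p%:Z - q%:Z) = x ^+ p / x ^+ q.
Proof. by move=> x0; rewrite expfzDr// exprnN. Qed.
End determinant_value.

(** * The cases of distinct and of equal multiplicities at 0 *)

Section cases.
Local Open Scope complex_scope.
Local Open Scope ring_scope.
Variable R : realType.
Local Notation C := R[i].
Variables (P1 P2 V : {poly C}) (ld : nat) (n : 'I_ld.+1 -> nat) (T : 'I_ld.+1 -> seq nat).
Hypothesis hP1 : P1 != 0.
Hypothesis hP2 : P2 != 0.
Hypothesis hdef : forall z, closed_disc 1 z -> V.[z] != 0.
Hypothesis hbd1 : forall z, closed_disc 1 z -> modulus (P1.[z] / V.[z]) <= 1.
Hypothesis hbd2 : forall z, closed_disc 1 z -> modulus (P2.[z] / V.[z]) <= 1.
Hypothesis hT : lacunary_family n T.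
Hypothesis hm : (0 < nb_param T)%N.

Local Notation a l i := (t_ T l i).-1.
Local Notation m := (nb_param T).
Local Notation nu1 := (val0 P1).
Local Notation nu2 := (val0 P2).
Local Notation alpha0 := (redcoef P1 0).
Local Notation a0 := (redcoef P2 0).
Local Notation beta0 := (V.[0]).

Lemma beta0_neq0 : beta0 != 0.
Proof.
have h : modulus (0 : C) = 0 := ComplexField.Normc.normc0 R.
by apply: hdef; rewrite /closed_disc /mkset h ler01.
Qed.

Lemma zeros_neq : (nu2 < nu1)%N ->
  (forall l l' : 'I_ld.+1, l' = l.+1 :> nat ->
     (nu_tilde n T nu1 nu2 l < nu_bar n T nu1 nu2 l')%N) ->
  exists2 Z, max_nb_zeros (fun lam : param T C => g_ n P1 P2 V lam)
      [set lam | exists2 z, closed_disc 1 z & g_ n P1 P2 V lam z != 0]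
      (closed_disc 4^-1) Z
    & Z%:R <= 5 * (nu_tilde n T nu1 nu2 ord_max + 1)%:R * ln 2
                  + 5 / 2 * m.+1%:R * ln m%:R
                  + 5 * ((t_bar T)%:R - m%:R)
                      * ln (modulus beta0 / modulus alpha0)
                  + 5 * ((taun_bar n T)%:R - ((t_bar T)%:R - m%:R))
                      * ln (modulus beta0 / modulus a0).
Proof.
move=> nu21 lac.
have [p1 [P1E p1E p10]] := val0_factor hP1.
have [p2 [P2E p2E p20]] := val0_factor hP2.
have b0 := beta0_neq0.
pose ord l x := (x * nu1 + (n l - x) * nu2)%N.
have ord_mono l x y : (x <= y)%N -> (y <= n l)%N -> (ord l x <= ord l y)%N.
  by rewrite /ord => xy yn; nia.
have barE l : nu_bar n T nu1 nu2 l = ord l (a l 0).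
  by rewrite /nu_bar /tmin /t_ nth0.
have tildeE l : nu_tilde n T nu1 nu2 l = ord l (a l (tau T l).-1).
  by rewrite /nu_tilde /tmax /t_ /tau nth_last.
have tau0 := tau_gt0 hT.
have ord_le l i : (i < tau T l)%N ->
    (nu_bar n T nu1 nu2 l <= ord l (a l i) <= nu_tilde n T nu1 nu2 l)%N.
  move=> it; have t0 := tau0 l; have tl : ((tau T l).-1 < tau T l)%N by rewrite prednK.
  have le0 := a_le hT (leq0n i) it.
  have le1 : (a l i <= a l (tau T l).-1)%N.
    by apply: (a_le hT) => //; rewrite -ltnS prednK.
  rewrite barE tildeE !ord_mono//; exact: (lacunary_a_le hT).
have uv l : (nu_bar n T nu1 nu2 l <= nu_tilde n T nu1 nu2 l)%N.
  by have /andP[/leq_trans] := ord_le l 0 (tau0 l); apply.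
pose r (l : 'I_ld.+1) (i : nat) := ord l (a l i).
pose Dl (l : 'I_ld.+1) : C :=
  \prod_(i < tau T l) ((alpha0 / beta0) ^+ a l i * (a0 / beta0) ^+ (n l - a l i)).
have [|w Tw Vw|l|Z HZ ZB] := max_nb_zeros_bound hdef hbd1 hbd2 hT (r := r)
    (N := nu_tilde n T nu1 nu2 ord_max) (Dl := Dl) hm.
- move=> l i /ord_le/andP[_ h].
  exact: leq_trans h (lacunary_le_max uv lac l).
- have F1E : P1 * w = 'X^nu1 * (p1 * w) by rewrite {1}P1E mulrA.
  have F2E : P2 * w = 'X^nu2 * (p2 * w) by rewrite {1}P2E mulrA.
  split=> [l|l l' ll'].
    rewrite /block F1E F2E (det_block_neq _ _ nu21 (fun i j => @a_lt _ _ _ hT l i j))//.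
      by apply: eq_bigr => i _; rewrite !(coef0_mul_inverse _ Vw) p1E p2E.
    by move=> i; exact: (lacunary_a_le hT).
  apply/matrixP => s i; rewrite !mxE F1E F2E coef_monomial_lt//.
  have /andP[_ h1] := ord_le l s (ltn_ord s).
  have /andP[h2 _] := ord_le l' i (ltn_ord i).
  exact: leq_ltn_trans h1 (leq_trans (lacunary_chain uv lac ll') h2).
- by apply/prodf_neq0 => i _; rewrite mulf_neq0// expf_neq0// mulf_neq0// invr_eq0.
exists Z => //; apply: le_trans ZB _.
have -> : \prod_l Dl l = (alpha0 / beta0) ^+ (\sum_l \sum_(i < tau T l) a l i)%N
    * (a0 / beta0) ^+ (\sum_l \sum_(i < tau T l) (n l - a l i))%N.
  rewrite -(prod_powers T _ (fun l i => a l i)).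
  rewrite -(prod_powers T _ (fun l i => n l - a l i)%N) -big_split/=.
  by apply: eq_bigr => l _; rewrite -big_split.
have := sum_n_a hT; have := sum_a hT.
move: (\sum_l \sum_(i < _) (n l - a l i))%N => e2.
move: (\sum_l \sum_(i < _) a l i)%N => e1 <- <-.
rewrite modulusM !modulusX !modulusM !modulusV.
have A0 := modulus_gt0 p10; have B0 := modulus_gt0 p20; have C0 := modulus_gt0 b0.
have m0 : 0 < m%:R :> R by rewrite ltr0n.
rewrite !ln_div ?posrE ?mulr_gt0 ?exprn_gt0 ?powR_gt0 ?divr_gt0//.
rewrite lnM ?posrE ?exprn_gt0 ?divr_gt0// !lnXn ?divr_gt0//.
rewrite !ln_div ?posrE// ln_powR -[_ *+ e1]mulr_natl -[_ *+ e2]mulr_natl addn1.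
by rewrite (natrD _ e1) (natrD _ e2) le_eqVlt; apply/orP; left; apply/eqP; field.
Qed.

Lemma zeros_eq k : nu1 = nu2 -> agree_max P1 P2 k ->
  (forall l l' : 'I_ld.+1, l' = l.+1 :> nat ->
     (nu2 * n l + k.+1 * (tau T l).-1 < nu2 * n l')%N) ->
  exists2 Z, max_nb_zeros (fun lam : param T C => g_ n P1 P2 V lam)
      [set lam | exists2 z, closed_disc 1 z & g_ n P1 P2 V lam z != 0]
      (closed_disc 4^-1) Z
    & Z%:R <= 5 * ((nu2 * n ord_max)%:R + k.+1%:R * (tau T ord_max)%:R - k%:R) * ln 2
                  + 5 * ln (2 + 4 * (m%:R `^ (m.+1%:R / 2))
                       / (3 * C_bar T R
                          * modulus (mu P1 P2)
                              ^ ((t_bar T)%:Z - (tau_bar T)%:Z)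
                          * modulus (a0 / beta0)
                              ^ ((taun_bar n T)%:Z - (tau_bar' T)%:Z)
                          * modulus (delta P1 P2 k / beta0) ^+ tau_bar' T)).
Proof.
move=> nu12 hk lac; have [agk maxk] := hk.
have [p1 [P1E p1E p10]] := val0_factor hP1.
have [p2 [P2E p2E p20]] := val0_factor hP2.
have b0 := beta0_neq0.
set mu0 := mu P1 P2; set dk := delta P1 P2 k.
have mu_neq0 : mu0 != 0 by rewrite /mu0 /mu mulf_neq0// invr_eq0.
have dk0 : dk != 0 by exact: delta_neq0.
have [q PE q0] : exists2 q, P1 = mu0 *: P2 + 'X^(nu2 + k.+1) * q & q`_0 = dk.
  have low i : (i < nu2 + k.+1)%N -> (P1 - mu0 *: P2)`_i = 0.
    move=> ik; rewrite coefB coefZ P1E nu12 {2}P2E !coefXnM.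
    case: ltnP => [_|h]; first by rewrite mulr0 subrr.
    by rewrite p1E p2E agk ?subrr//; lia.
  exists (drop_poly (nu2 + k.+1) (P1 - mu0 *: P2)).
    by rewrite -(polyXn_factor low) addrC subrK.
  rewrite coef_drop_poly add0n coefB coefZ.
  by rewrite /dk /delta /redcoef nu12.
have tau0 := tau_gt0 hT.
pose u (l : 'I_ld.+1) := (nu2 * n l)%N.
pose v (l : 'I_ld.+1) := (nu2 * n l + k.+1 * (tau T l).-1)%N.
have uv l : (u l <= v l)%N by exact: leq_addr.
pose r (l : 'I_ld.+1) (i : nat) := (nu2 * n l + k.+1 * i)%N.
have rv l i : (i < tau T l)%N -> (r l i <= v l)%N.
  by move=> it; rewrite leq_add2l leq_mul2l/= -ltnS prednK.
pose Dl (l : 'I_ld.+1) : C :=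
  \prod_(i < tau T l) ((\prod_(j < i) ((a l i)%:R - (a l j)%:R)) / i`!%:R)
    * \prod_(i < tau T l) (mu0 ^+ a l i / mu0 ^+ i)
    * \prod_(i < tau T l) ((a0 / beta0) ^+ (n l - i) * (dk / beta0) ^+ i).
have [|w Tw Vw|l|Z HZ ZB] := max_nb_zeros_bound hdef hbd1 hbd2 hT (r := r)
    (N := v ord_max) (Dl := Dl) hm.
- by move=> l i /rv h; exact: leq_trans h (lacunary_le_max uv lac l).
- have F2E : P2 * w = 'X^nu2 * (p2 * w) by rewrite {1}P2E mulrA.
  have F1E : P1 * w = mu0 *: ('X^nu2 * (p2 * w)) + 'X^(nu2 + k.+1) * (q * w).
    by rewrite {1}PE mulrDl -scalerAl F2E -mulrA.
  split=> [l|l l' ll'].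
    rewrite /block F1E F2E /r.
    rewrite (det_block_eq (a := fun i => a l i) _ _ _ (ltn0Sn k) mu_neq0 (tau_le hT l)).
      congr (_ * _); apply: eq_bigr => i _.
      by rewrite !(coef0_mul_inverse _ Vw) p2E q0.
    by move=> i; exact: (lacunary_a_le hT).
  (* Off the diagonal only the order ν n_l' of the monomials matters, so the plain factorisation of
     P1 suffices. *)
  have F1E' : P1 * w = 'X^nu2 * (p1 * w) by rewrite {1}P1E nu12 mulrA.
  apply/matrixP => s i; rewrite !mxE F1E' F2E coef_monomial_lt// -mulnDl.
  rewrite subnKC ?(lacunary_a_le hT)// mulnC.
  exact: leq_ltn_trans (rv l s (ltn_ord s)) (lacunary_chain uv lac ll').
- rewrite /Dl; apply: mulf_neq0; first apply: mulf_neq0.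
  + apply/prodf_neq0 => i _; rewrite mulf_neq0 ?invr_eq0 ?pnatr_eq0 -?lt0n ?fact_gt0//.
    apply/prodf_neq0 => j _; rewrite subr_eq0 eqr_nat gtn_eqF//.
    exact: (a_lt hT).
  + by apply/prodf_neq0 => i _; rewrite mulf_neq0 ?invr_eq0 ?expf_neq0.
  + apply/prodf_neq0 => i _; rewrite mulf_neq0// expf_neq0// mulf_neq0// invr_eq0//.
exists Z => //; apply: le_trans ZB _.
have m0 : 0 < m%:R :> R by rewrite ltr0n.
have dE : modulus (\prod_l Dl l) = C_bar T R
    * modulus mu0 ^ ((t_bar T)%:Z - (tau_bar T)%:Z)
    * modulus (a0 / beta0) ^ ((taun_bar n T)%:Z - (tau_bar' T)%:Z)
    * modulus (dk / beta0) ^+ tau_bar' T.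
  pose e1 := (\sum_l \sum_(i < tau T l) a l i)%N.
  pose e2 := (\sum_l \sum_(i < tau T l) (n l - i))%N.
  have -> : \prod_l Dl l = (C_bar T R)%:C * (mu0 ^+ e1 / mu0 ^+ tau_bar' T)
      * ((a0 / beta0) ^+ e2 * (dk / beta0) ^+ tau_bar' T).
    rewrite /Dl !big_split/= (C_barE _ hT) -sum_i /e1 /e2.
    rewrite -(prod_powers T _ (fun l i => a l i)) -!(prod_powers T _ (fun l i => i)).
    rewrite -(prod_powers T _ (fun l i => n l - i)%N) -prodfV -!big_split/=.
    congr (_ * _ * _); apply: eq_bigr => l _; rewrite ?prodfV -?big_split//=.
    by rewrite -prodfV -big_split.
  (* Stating this for variables keeps the moduli of the quotients by [beta0] unsplit, as in the
     target. *)
  have modE (c x y z t : C) : modulus (c * (x / y) * (z * t)) =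
      modulus c * (modulus x / modulus y) * (modulus z * modulus t).
    by rewrite !modulusM modulusV.
  rewrite modE !modulusX.
  have -> : modulus (C_bar T R)%:C = C_bar T R.
    have := @norm_modulus R (C_bar T R)%:C.
    rewrite ger0_norm ?lecR ?ltW ?C_bar_gt0//; first by case.
    exact: C_bar_gt0 hT.
  have h1 := sum_a hT; have h2 := sum_n_i hT; have h3 := tau_barE hT.
  rewrite (sum_i T) in h2.
  rewrite (_ : (t_bar T)%:Z - (tau_bar T)%:Z = e1%:Z - (tau_bar' T)%:Z); last first.
    by rewrite /e1; lia.
  rewrite (_ : (taun_bar n T)%:Z - (tau_bar' T)%:Z = e2%:Z); last by rewrite /e2; lia.
  by rewrite expfz_nat ?gt_eqF ?modulus_gt0// !mulrA.
have d0 : 0 < modulus (\prod_l Dl l).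
  have A1 : 0 < modulus (a0 / beta0) by rewrite modulus_gt0// mulf_neq0// invr_eq0.
  have B1 : 0 < modulus (dk / beta0) by rewrite modulus_gt0// mulf_neq0// invr_eq0.
  rewrite dE; apply: mulr_gt0; last exact: exprn_gt0.
  apply: mulr_gt0; last exact: exprz_gt0.
  apply: mulr_gt0; first exact: C_bar_gt0 hT.
  by apply: exprz_gt0; exact: modulus_gt0.
have -> : 3 * C_bar T R * modulus mu0 ^ ((t_bar T)%:Z - (tau_bar T)%:Z)
    * modulus (a0 / beta0) ^ ((taun_bar n T)%:Z - (tau_bar' T)%:Z)
    * modulus (dk / beta0) ^+ tau_bar' T = 3 * modulus (\prod_l Dl l).
  by rewrite dE !mulrA.
move: (modulus _) d0 => x x0 {dE}.
have M0 : 0 < m%:R `^ (m.+1%:R / 2) :> R by rewrite powR_gt0.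
move: (_ `^ _) M0 => y y0.
apply: lerD.
  (* Here N + 1 = ν d + (k+1)(τ-1) + 1 = ν d + (k+1)τ - k. *)
  rewrite le_eqVlt; apply/orP; left; apply/eqP; congr (_ * _ * _).
  rewrite /v; have := tau0 ord_max; case: (tau T _) => // t _ /=.
  by rewrite -natr1 natrD natrM -(natr1 t) -(natr1 k); ring.
apply: ler_wpM2l => //; rewrite ler_ln ?posrE ?divr_gt0//; last first.
  by rewrite addr_gt0// divr_gt0 ?mulr_gt0.
(* The bound obtained has y/x inside the logarithm, which is smaller than the stated 2 + 4y/(3x). *)
have -> : 4 * y / (3 * x) = y / x + y / x / 3 by field; rewrite gt_eqF.
have yx : 0 <= y / x by rewrite divr_ge0 ?ltW.
by rewrite addrCA lerDl addr_ge0// divr_ge0.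
Qed.
End cases.

Unset Implicit Arguments.

Theorem mainTheorem2 (R : realType) (P1 P2 V : {poly R[i]})
    (ld : nat) (n : 'I_ld.+1 -> nat) (T : 'I_ld.+1 -> seq nat) (k : nat)
    (nu1 := val0 P1) (nu2 := val0 P2) (nu := nu2)
    (alpha0 := redcoef P1 0) (a0 := redcoef P2 0) (beta0 := V.[0])
    (D := maxn (deg P1) (deg P2)) (d := n ord_max) (m := nb_param T)
    (dk := delta P1 P2 k)
    (hP1 : P1 != 0) (hP2 : P2 != 0)
    (hprop : forall c : R[i], P1 != c *: P2)
    (hX1 : 'X %| P1) (hX2 : 'X %| P2)
    (hV1 : coprimep P1 V) (hV2 : coprimep P2 V)
    (hbeta0 : beta0 != 0)
    (hnu21 : (nu2 <= nu1)%N) (hnu2 : (1 <= nu2)%N)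
    (hdef : forall z, closed_disc 1 z -> V.[z] != 0)
    (hbd1 : forall z, closed_disc 1 z -> modulus (P1.[z] / V.[z]) <= 1)
    (hbd2 : forall z, closed_disc 1 z -> modulus (P2.[z] / V.[z]) <= 1)
    (hk : nu1 = nu2 -> agree_max P1 P2 k)
    (hT : lacunary_family n T)
    (hm : (2 <= m)%N)
    (hlac : [\/ forall l l' : 'I_ld.+1, l' = l.+1 :> nat ->
                  (n l * D < nu * n l')%N,
                nu1 = nu2 /\ forall l l' : 'I_ld.+1, l' = l.+1 :> nat ->
                  (nu * n l + k.+1 * (tau T l).-1 < nu * n l')%N
              | nu1 <> nu2 /\ forall l l' : 'I_ld.+1, l' = l.+1 :> nat ->
                  (nu_tilde n T nu1 nu2 l < nu_bar n T nu1 nu2 l')%N]) :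
  exists Z : nat,
    [/\ max_nb_zeros (fun lam : param T R[i] => g_ n P1 P2 V lam)
          [set lam | exists2 z, closed_disc 1 z & g_ n P1 P2 V lam z != 0]
          (closed_disc 4^-1) Z,
        nu1 <> nu2 ->
          Z%:R <= 5 * (nu_tilde n T nu1 nu2 ord_max + 1)%:R * ln 2
                  + 5 / 2 * m.+1%:R * ln m%:R
                  + 5 * ((t_bar T)%:R - m%:R)
                      * ln (modulus beta0 / modulus alpha0)
                  + 5 * ((taun_bar n T)%:R - ((t_bar T)%:R - m%:R))
                      * ln (modulus beta0 / modulus a0)
      & nu1 = nu2 ->
          Z%:R <= 5 * ((nu * d)%:R + k.+1%:R * (tau T ord_max)%:R - k%:R) * ln 2
                  + 5 * ln (2 + 4 * (m%:R `^ (m.+1%:R / 2))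
                       / (3 * C_bar T R
                          * modulus (mu P1 P2)
                              ^ ((t_bar T)%:Z - (tau_bar T)%:Z)
                          * modulus (a0 / beta0)
                              ^ ((taun_bar n T)%:Z - (tau_bar' T)%:Z)
                          * modulus (dk / beta0) ^+ tau_bar' T))].
Proof.
have hm0 : (0 < m)%N by apply: leq_trans hm.
have D1 : (nu1 <= D)%N by rewrite (leq_trans (val0_le_deg hP1))// leq_maxl.
have D2 : (nu2 <= D)%N by rewrite (leq_trans (val0_le_deg hP2))// leq_maxr.
have [nu12|nu12] := eqVneq nu1 nu2.
  have kD := delta_le_deg (hk nu12) nu12.
  (* The first condition gives this one: τ_l - 1 ≤ n_l and ν + k + 1 ≤ D, so the left side is at
     most n_l D. *)
  have lac (l l' : 'I_ld.+1) : l' = l.+1 :> nat ->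
      (nu2 * n l + k.+1 * (tau T l).-1 < nu2 * n l')%N.
    move=> ll'; case: hlac => [h|[_ h]|[//]]; last exact: h.
    have := h l l' ll'; have := tau_le hT l; rewrite -/D in kD; rewrite /nu.
    move: (tau T l) (n l) (n l') kD => t x y; rewrite -/nu2; nia.
  have [Z HZ ZB] := zeros_eq hP1 hP2 hdef hbd1 hbd2 hT hm0 nu12 (hk nu12) lac.
  by exists Z; split.
have nu21 : (nu2 < nu1)%N by rewrite ltn_neqAle eq_sym nu12.
(* The first condition gives this one: both multiplicities are at most D, so [nu_tilde] at l is at
   most n_l D, while [nu_bar] at l' is at least ν n_l'. *)
have lac (l l' : 'I_ld.+1) : l' = l.+1 :> nat ->
    (nu_tilde n T nu1 nu2 l < nu_bar n T nu1 nu2 l')%N.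
  move=> ll'; case: hlac => [h|[e _]|[_ h]]; last exact: h.
    have := h l l' ll'; rewrite /nu_tilde /nu_bar /nu.
    have := lacunary_a_le hT (tau_gt0 hT l'); rewrite /t_ nth0 -/(tmin T l').
    have tl : ((tau T l).-1 < tau T l)%N by rewrite prednK// (tau_gt0 hT).
    have := lacunary_a_le hT tl; rewrite /t_ /tau nth_last -/(tmax T l).
    move: (tmax T l).-1 (tmin T l').-1 (n l) (n l') => p q x y px qy; nia.
  by rewrite e eqxx in nu12.
have [Z HZ ZB] := zeros_neq hP1 hP2 hdef hbd1 hbd2 hT hm0 nu21 lac.
by exists Z; split => // e; rewrite e eqxx in nu12.
Qed.
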